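(* Let $\{P_t\}_{t\geq 0}$ be a Markov--Feller semigroup on a Polish space $\mathcal{X}$. The following are equivalent: (i) $\{P_t\}_{t\geq 0}$ is weakly-* mean ergodic (with unique invariant measure $\mu$); (ii) $\{P_t\}_{t\geq 0}$ is Ces\`aro eventually continuous at every point of $\mathcal{X}$ and there exists $z\in\mathcal{X}$ such that for every $\epsilon>0$, $\inf_{x\in\mathcal{X}}\limsup_{t\to\infty}Q_t(x,B(z,\epsilon))>0$.
   Context: $(\mathcal{X},\rho)$ is a Polish space, $\mathcal{P}(\mathcal{X})$ the Borel probability measures, $B(z,\epsilon)$ the open ball. A Markov--Feller semigroup $\{P_t\}_{t\ge0}$ is a semigroup of mass-preserving positively linear operators on finite Borel measures, each with a dual linear operator on bounded Borel functions ($\langle f,P_t\mu\rangle=\langle P_tf,\mu\rangle$) preserving bounded continuous functions. For $t>0$: $Q_tf(x)=\frac1t\int_0^tP_sf(x)\,ds$, $Q_t\nu=\frac1t\int_0^tP_s\nu\,ds$, $Q_t(x,\cdot)=Q_t\delta_x$. Weakly-* mean ergodic: there is a unique invariant probability measure $\mu_*$ and $Q_t\nu\to\mu_*$ weakly as $t\to\infty$ for every $\nu\in\mathcal{P}(\mathcal{X})$. Ces\`aro eventually continuous at $z$: for every bounded Lipschitz $f$, $\limsup_{x\to z}\limsup_{t\to\infty}|Q_tf(x)-Q_tf(z)|=0$. *)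

(* Defs.v *)
From HB Require Import structures.
From mathcomp Require Import all_boot all_order all_algebra.
From mathcomp Require Import all_classical all_reals all_analysis.
From mathcomp Require Import measurable_realfun.
Set Implicit Arguments.
Unset Strict Implicit.
Unset Printing Implicit Defensive.
Import Order.TTheory GRing.Theory Num.Theory.
Import numFieldNormedType.Exports.
Local Open Scope classical_set_scope.
Local Open Scope ring_scope.

Section MetricDefs.
Context {R : realType} {X : pointedType} (rho : X -> X -> R).

Definition is_metric : Prop :=
  [/\ (forall x y, 0 <= rho x y),
      (forall x y, rho x y = 0 <-> x = y),
      (forall x y, rho x y = rho y x) &
      (forall x y z, rho x z <= rho x y + rho y z)].

Definition metric_complete : Prop :=
  forall u : nat -> X,
    (forall e, 0 < e -> exists N, forall m n, (N <= m)%N -> (N <= n)%N ->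
        rho (u m) (u n) < e) ->
    exists x, forall e, 0 < e -> exists N, forall n, (N <= n)%N -> rho (u n) x < e.

Definition metric_separable : Prop :=
  exists u : nat -> X, forall x e, 0 < e -> exists n, rho x (u n) < e.

Definition polish_metric : Prop :=
  [/\ is_metric, metric_complete & metric_separable].

Definition rball (z : X) (e : R) : set X := [set x | rho z x < e].

Definition rho_open : set (set X) :=
  [set A | forall x, A x -> exists2 r, 0 < r & rball x r `<=` A].

Definition bounded_fun (f : X -> R) : Prop :=
  exists M, forall x, `|f x| <= M.

Definition rho_continuous (f : X -> R) : Prop :=
  forall x e, 0 < e -> exists2 d, 0 < d &
    forall y, rho x y < d -> `|f x - f y| < e.

Definition bounded_continuous (f : X -> R) : Prop :=
  bounded_fun f /\ rho_continuous f.

Definition lipschitz_fun (f : X -> R) : Prop :=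
  exists L, forall x y, `|f x - f y| <= L * rho x y.

Definition bounded_lipschitz (f : X -> R) : Prop :=
  bounded_fun f /\ lipschitz_fun f.

Definition rho_limsup (z : X) (g : X -> \bar R) : \bar R :=
  ereal_inf [set ereal_sup (g @` rball z d) | d in [set d : R | 0 < d]].

End MetricDefs.

Notation Borel rho := (g_sigma_algebraType (rho_open rho)).

Section MarkovDefs.
Context {R : realType} {X : pointedType} (rho : X -> X -> R).

(** A semigroup is given by its transition probabilities
    P t x = P_t delta_x (a Borel probability measure).
    Then P_t nu (A) = \int P t x A d nu(x) and
    P_t f (x) = \int f d(P t x). *)
Variable P : R -> X -> probability (Borel rho) R.

Definition Pf (t : R) (f : X -> R) (x : X) : R :=
  \int[P t x]_(y in [set: Borel rho]) f y.

Definition markov_feller_semigroup : Prop :=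
  [/\
      (forall t (A : set (Borel rho)), 0 <= t -> measurable A ->
          measurable_fun [set: Borel rho] (fun x => P t x A)),
      (forall x (A : set (Borel rho)), measurable A -> P 0 x A = @dirac _ (Borel rho) x R A),
      (forall s t x (A : set (Borel rho)), 0 <= s -> 0 <= t -> measurable A ->
          P (s + t) x A = (\int[P s x]_y P t y A)%E),
      (forall t f, 0 <= t -> bounded_continuous rho f ->
          rho_continuous rho (Pf t f)) &
      (* measurability in time (needed for the Cesaro averages Q_t) *)
      (forall x (A : set (Borel rho)), measurable A ->
          measurable_fun (`[0%R, +oo[%classic : set R) (fun s : R => P s x A))].

Definition Qf (t : R) (f : X -> R) (x : X) : R :=
  t^-1 * \int[lebesgue_measure]_(s in `[0, t]) Pf s f x.

Definition Qx (t : R) (x : X) (A : set (Borel rho)) : R :=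
  t^-1 * \int[lebesgue_measure]_(s in `[0, t]) fine (P s x A).

(** <f, Q_t nu> = 1/t \int_0^t <f, P_s nu> ds = 1/t \int_0^t <P_s f, nu> ds *)
Definition Qpair (nu : probability (Borel rho) R) (t : R) (f : X -> R) : R :=
  t^-1 * \int[lebesgue_measure]_(s in `[0, t])
            \int[nu]_(x in [set: Borel rho]) Pf s f x.

Definition invariant (mu : probability (Borel rho) R) : Prop :=
  forall t (A : set (Borel rho)), 0 <= t -> measurable A ->
    (\int[mu]_x P t x A)%E = mu A.

Definition weakly_mean_ergodic : Prop :=
  exists mu : probability (Borel rho) R,
    [/\ invariant mu,
        (forall nu : probability (Borel rho) R, invariant nu ->
            forall A : set (Borel rho), measurable A -> nu A = mu A) &
        (forall (nu : probability (Borel rho) R) (f : X -> R),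
            bounded_continuous rho f ->
            (fun t => Qpair nu t f) @ +oo -->
              \int[mu]_(x in [set: Borel rho]) f x)].

Definition cesaro_ev_continuous (z : X) : Prop :=
  forall f : X -> R, bounded_lipschitz rho f ->
    rho_limsup rho z
      (fun x => limf_esup (fun t => (`|Qf t f x - Qf t f z|)%:E) +oo) = 0%E.

End MarkovDefs.

(* Main.v *)
(**
  If the averages converge, the point [z] may be any point of the support of the
  invariant measure. Conversely, for bounded Lipschitz [f] put
  [D x = limsup_t |Q_t f x - Q_t f z|] and [M = sup D]. From every [x] some [P_s]
  charges a ball around [z], on which [D <= eta] by eventual continuity, with mass at
  least some [c] independent of [x]; since [Q_t P_s] and [Q_t] are asymptotically
  equal, [D x <= c eta + (1 - c) M], so [M <= eta] and all averages are
  asymptotically equal.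

  The main point is that the averages [Q_t(z, .)] are tight. If not, there are
  times [q_i] and bumps [f_i] with far apart supports such that
  [Q_{q_i} f_i z >= eps]. Every union of the bumps is Lipschitz, so Schur's gliding
  hump shows that at each [y] one has [Q_{q_i} f_i y >= eps / 2] for large [i], and
  by Baire this holds uniformly in [i >= k] on a ball [B] which the orbit of [z]
  visits. By the Feller property and the lower bound at [z], [B] keeps mass [b > 0]
  along arbitrarily large times, at which each of arbitrarily many disjoint [f_i]
  gets mass about [eps b / 2]: a contradiction.

  By tightness, the limit of [Q_t f z] along an ultrafilter is a functional of [f]
  which is continuous along decreasing sequences (Dini), hence is represented by an
  invariant probability measure; integrating the asymptotic equality of the averages
  against it identifies the limit.
*)

Require Import Defs.
From HB Require Import structures.
From mathcomp Require Import all_boot all_order all_algebra.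
From mathcomp Require Import all_classical all_reals all_analysis.
From mathcomp Require Import measurable_realfun giry lra.
Import Order.TTheory GRing.Theory Num.Theory.
Import numFieldNormedType.Exports.
Local Open Scope classical_set_scope.
Local Open Scope ring_scope.
Set Implicit Arguments.
Unset Strict Implicit.
Unset Printing Implicit Defensive.

(** * Integrals of bounded functions against probabilities *)

(** The space need not be locally compact, so tightness has to come from the dynamics alone.
    Eventual continuity speaks of one Lipschitz function at a time, with no rate uniform in the
    function. This is why all bumps share one radius: any infinite union of them is again one
    bounded Lipschitz function, to which the asymptotic equality of the averages applies, and the
    gliding hump can run. Baire's argument has to return a ball that is visible from [z]. Hence the
    nested balls are picked among those that some [P s z] charges. The exceptional set left in the
    resulting ball need not be empty; it is null for every [P s z], which is enough because mass is
    only counted from [z]. The inner times [q i] are fixed before the outer time [t], so replacing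
    [Q_t Q_q] by [Q_t] costs only [O(q / t)]. For the same reason the representation theorem assumes
    continuity along decreasing sequences instead of compact supports. Tightness is used as total
    boundedness, by finite nets at every radius, and completeness then supplies the limit points. *)

Section bounded_integral.
Context d (T : measurableType d) (R : realType).
Implicit Types (c : R) (nu : probability T R) (f g : T -> R).

Definition bounded_mfun f :=
  measurable_fun setT f /\ exists M, forall x, `|f x| <= M.

Lemma bounded_mfunD f g : bounded_mfun f -> bounded_mfun g ->
  bounded_mfun (fun x => f x + g x).
Proof.
move=> [mf [M fM]] [mg [N gN]]; split; first exact: measurable_funD.
by exists (M + N) => x; rewrite (le_trans (ler_normD _ _))// lerD.
Qed.

Lemma bounded_mfunZ c f : bounded_mfun f -> bounded_mfun (fun x => c * f x).
Proof.
move=> [mf [M fM]]; split; first exact: measurable_funM.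
by exists (`|c| * M) => x; rewrite normrM ler_wpM2l.
Qed.

Lemma bounded_mfunB f g : bounded_mfun f -> bounded_mfun g ->
  bounded_mfun (fun x => f x - g x).
Proof.
move=> [mf [M fM]] [mg [N gN]]; split; first exact: measurable_funB.
by exists (M + N) => x; rewrite (le_trans (ler_normB _ _))// lerD.
Qed.

Lemma bounded_mfun_cst c : bounded_mfun (fun=> c).
Proof. by split=> //; exists `|c|. Qed.

Lemma bounded_mfun_norm f : bounded_mfun f -> bounded_mfun (fun x => `|f x|).
Proof.
move=> [mf [M fM]]; split; first exact: measurableT_comp.
by exists M => x; rewrite normr_id.
Qed.

Lemma bounded_mfun_indic (A : set T) : measurable A ->
  bounded_mfun (\1_A : T -> R).
Proof.
move=> mA; split; first exact: measurable_indic.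
exists 1 => x; rewrite indicE; case: (_ \in _) => /=.
  by rewrite normr1.
by rewrite normr0.
Qed.

Lemma bounded_mfun_integrable nu f : bounded_mfun f ->
  nu.-integrable setT (EFin \o f).
Proof.
move=> [mf [M fM]]; apply: measurable_bounded_integrable => //.
  by apply: (le_lt_trans (probability_le1 nu measurableT)); rewrite ltry.
exists M; split; first exact: num_real.
by move=> N MN x _ /=; rewrite (le_trans (fM x))// ltW.
Qed.

Lemma int_cst nu (c : R) : \int[nu]_x c = c.
Proof.
rewrite Rintegral_cst//; have -> : (nu : {measure set T -> \bar R}) setT = 1%E := probability_setT nu.
by rewrite mulr1.
Qed.

Lemma intD nu f g : bounded_mfun f -> bounded_mfun g ->
  \int[nu]_x (f x + g x) = \int[nu]_x f x + \int[nu]_x g x.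
Proof. by move=> bf bg; rewrite RintegralD//; apply: bounded_mfun_integrable. Qed.

Lemma intB nu f g : bounded_mfun f -> bounded_mfun g ->
  \int[nu]_x (f x - g x) = \int[nu]_x f x - \int[nu]_x g x.
Proof. by move=> bf bg; rewrite RintegralB//; apply: bounded_mfun_integrable. Qed.

Lemma intZ nu c f : bounded_mfun f ->
  \int[nu]_x (c * f x) = c * \int[nu]_x f x.
Proof. by move=> bf; rewrite RintegralZl//; apply: bounded_mfun_integrable. Qed.

Lemma le_int nu f g : bounded_mfun f -> bounded_mfun g ->
  (forall x, f x <= g x) -> \int[nu]_x f x <= \int[nu]_x g x.
Proof.
by move=> bf bg fg; apply: le_Rintegral => //; apply: bounded_mfun_integrable.
Qed.

Lemma int_norm_le nu f M : measurable_fun setT f -> (forall x, `|f x| <= M) ->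
  `|\int[nu]_x f x| <= M.
Proof.
move=> mf fM; have bf : bounded_mfun f by split=> //; exists M.
rewrite (le_trans (le_normr_Rintegral _ _))//.
  exact: bounded_mfun_integrable.
rewrite -[leRHS](int_cst nu); apply: le_int => //.
  exact: bounded_mfun_norm.
exact: bounded_mfun_cst.
Qed.

Lemma int_indic nu (A : set T) : measurable A ->
  \int[nu]_x \1_A x = fine (nu A).
Proof. by move=> mA; rewrite /Rintegral integral_indic// setIT. Qed.

Lemma int_cvg nu (f : nat -> T -> R) g M :
  (forall n, measurable_fun setT (f n)) ->
  (forall n x, `|f n x| <= M) ->
  (forall x, f n x @[n --> \oo] --> g x) ->
  \int[nu]_x f n x @[n --> \oo] --> \int[nu]_x g x.
Proof.
move=> mf fM fg.
have mg : measurable_fun setT g.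
  by apply: (measurable_fun_cvg mf) => x _; exact: fg.
have [|||||_ _ h] := @dominated_convergence _ _ _ nu setT measurableT
  (fun n => EFin \o f n) (EFin \o g) (EFin \o cst M).
- by move=> n; exact/measurable_EFinP.
- exact/measurable_EFinP.
- by apply/aeW => x _; apply: cvg_EFin; [near=> n|exact: fg].
- exact/bounded_mfun_integrable/bounded_mfun_cst.
- by apply/aeW => x n _ /=; rewrite lee_fin.
have gM x : `|g x| <= M.
  have h1 : `|f n x| @[n --> \oo] --> `|g x| by apply: cvg_norm; exact: fg.
  rewrite -(cvg_lim _ h1)//; apply: limr_le; first by apply/cvg_ex; eexists; exact: h1.
  by near=> n; exact: fM.
apply: fine_cvg; rewrite fineK; first exact: h.
by apply: integrable_fin_num => //; apply: bounded_mfun_integrable; split=> //; exists M.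
Unshelve. all: by end_near. Qed.

(** Convergence at [+oo] can be tested along sequences, where bounded convergence applies. The
    hypotheses range over all [t], including the [t <= 0] at which averages take default values. *)
Lemma int_cvg_pinfty nu (f : R -> T -> R) g M :
  (forall t, measurable_fun setT (f t)) ->
  (forall t x, `|f t x| <= M) ->
  (forall x, f t x @[t --> +oo] --> g x) ->
  \int[nu]_x f t x @[t --> +oo] --> \int[nu]_x g x.
Proof.
move=> mf fM fg; apply/cvg_pinftyP => u uoo.
apply: (int_cvg (M := M)) => // x.
by move/cvg_pinftyP : (fg x); exact.
Qed.

End bounded_integral.

(** * Mixtures of probabilities and Fubini for bounded functions *)

Section bind.
Context d1 d2 (T1 : measurableType d1) (T2 : measurableType d2) (R : realType).

(** For nonnegative integrands iterated integrals raise no integrability question. A bounded [f] is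
    replaced by [f + M], and [M] cancels because every measure involved has mass one. The same shift
    serves for Fubini and for uniform laws. *)
Lemma int_bind (nu : probability T1 R) (k : T1 -> probability T2 R)
    (kappa : probability T2 R) (f : T2 -> R) :
  (forall A, measurable A -> measurable_fun setT (fun y => k y A)) ->
  (forall A, measurable A -> kappa A = \int[nu]_y k y A)%E ->
  bounded_mfun f ->
  bounded_mfun (fun y => \int[k y]_x f x) /\
  \int[kappa]_x f x = \int[nu]_y \int[k y]_x f x.
Proof.
move=> mk kE.
have H (h : T2 -> R) : bounded_mfun h -> (forall x, 0 <= h x) ->
  bounded_mfun (fun y => \int[k y]_x h x) /\
  \int[kappa]_x h x = \int[nu]_y \int[k y]_x h x.
  move=> bh h0; have mh := bh.1; have [M hM] := bh.2.
  pose kk : T1 -> giry T2 R := fun y => k y.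
  have mkk : measurable_fun setT kk by apply: measurable_giry_codensity.
  have int1 : measurable_fun setT (fun y => \int[k y]_x (h x)%:E)%E.
    apply: measurable_fun_integral_kernel.
    - exact: mk.
    - by move=> z; rewrite lee_fin.
    - exact/measurable_EFinP.
  have fin y : (\int[k y]_x (h x)%:E = (\int[k y]_x h x)%:E)%E.
    rewrite fineK//; apply: integrable_fin_num => //.
    exact: bounded_mfun_integrable.
  split; first split.
  - by apply/measurable_EFinP; apply: eq_measurable_fun int1 => y _; rewrite fin.
  - by exists M => y; exact: int_norm_le.
  rewrite /Rintegral; congr fine.
  have HE := @giry_int_bind _ _ T1 T2 R nu kk mkk (EFin \o h) _ _.
  transitivity (\int[giry_bind nu mkk]_x (h x)%:E)%E.
    apply: eq_measure_integral => A mA _.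
    transitivity (\int[nu]_y k y A)%E; first exact: kE.
    symmetry; apply: (@giry_int_map _ _ _ _ _ _ mkk nu (giry_ev ^~ A)) => //.
    exact: measurable_giry_ev.
  have := HE _ _; rewrite /giry_int => ->.
  - by apply: eq_integral => y _ /=; rewrite fin.
  - exact/measurable_EFinP.
  - by move=> x; rewrite lee_fin.
move=> bf; have [mf [M fM]] := bf.
have bh : bounded_mfun (fun x => f x + M).
  exact: bounded_mfunD (bounded_mfun_cst _ _).
have [] := H _ bh.
  by move=> x; have := fM x; rewrite ler_norml => /andP[]; rewrite -lerBlDr sub0r.
move=> bi iE.
have kf y : \int[k y]_x (f x + M) = \int[k y]_x f x + M.
  by rewrite intD// ?int_cst//; exact: bounded_mfun_cst.
have bi' : bounded_mfun (fun y => \int[k y]_x f x).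
  have -> : (fun y => \int[k y]_x f x) = (fun y => \int[k y]_x (f x + M) - M).
    by apply/funext => y; rewrite kf addrK.
  exact: bounded_mfunB bi (bounded_mfun_cst _ M).
split => //.
move: iE; rewrite intD//; last exact: bounded_mfun_cst.
rewrite int_cst (_ : (fun y => _) = (fun y => \int[k y]_x f x + M)); last exact/funext.
rewrite intD//; last exact: bounded_mfun_cst.
by rewrite int_cst => /addIr.
Qed.

End bind.

Section fubini.
Context d1 d2 (T1 : measurableType d1) (T2 : measurableType d2) (R : realType).
Variables (m1 : probability T1 R) (m2 : probability T2 R).

Lemma int_fubini (f : T1 * T2 -> R) : bounded_mfun f ->
  [/\ bounded_mfun (fun x => \int[m2]_y f (x, y)),
      bounded_mfun (fun y => \int[m1]_x f (x, y)) &
      \int[m1]_x \int[m2]_y f (x, y) = \int[m2]_y \int[m1]_x f (x, y)].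
Proof.
have H (h : T1 * T2 -> R) : bounded_mfun h -> (forall x, 0 <= h x) ->
  [/\ bounded_mfun (fun x => \int[m2]_y h (x, y)),
      bounded_mfun (fun y => \int[m1]_x h (x, y)) &
      \int[m1]_x \int[m2]_y h (x, y) = \int[m2]_y \int[m1]_x h (x, y)].
  move=> [mh [M hM]] h0.
  have mh1 y : measurable_fun setT (fun x => h (x, y)) by exact: measurableT_comp.
  have mh2 x : measurable_fun setT (fun y => h (x, y)) by exact: measurableT_comp.
  have fin2 x : (\int[m2]_y (h (x, y))%:E = (\int[m2]_y h (x, y))%:E)%E.
    rewrite fineK//; apply: integrable_fin_num => //.
    by apply: bounded_mfun_integrable; split=> //; exists M.
  have fin1 y : (\int[m1]_x (h (x, y))%:E = (\int[m1]_x h (x, y))%:E)%E.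
    rewrite fineK//; apply: integrable_fin_num => //.
    by apply: bounded_mfun_integrable; split=> //; exists M.
  have mhE : measurable_fun setT (EFin \o h) by exact/measurable_EFinP.
  have h0E z : (0 <= (EFin \o h) z)%E by rewrite lee_fin.
  split.
  - split; last by exists M => x; exact: int_norm_le.
    have := @measurable_fun_fubini_tonelli_F _ _ _ _ _ m2 _ mhE h0E.
    by move=> mF; apply/measurable_EFinP; apply: eq_measurable_fun mF => x _; exact: fin2.
  - split; last by exists M => x; exact: int_norm_le.
    have := @measurable_fun_fubini_tonelli_G _ _ _ _ _ m1 _ mhE h0E.
    by move=> mF; apply/measurable_EFinP; apply: eq_measurable_fun mF => x _; exact: fin1.
  - rewrite /Rintegral; congr fine.
    have := @fubini_tonelli _ _ _ _ _ m1 m2 _ mhE h0E.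
    rewrite /fubini_F /fubini_G /= => FT.
    transitivity (\int[m1]_x \int[m2]_y (h (x, y))%:E)%E.
      by apply: eq_integral => x _; rewrite fin2.
    by rewrite FT; apply: eq_integral => x _; rewrite fin1.
move=> bf; have [mf [M fM]] := bf.
have b1 y : bounded_mfun (fun x => f (x, y)).
  by split; [exact: measurableT_comp|exists M].
have b2 x : bounded_mfun (fun y => f (x, y)).
  by split; [exact: measurableT_comp|exists M].
have [||bi1 bi2 iE] := H (fun z => f z + M).
- exact: bounded_mfunD (bounded_mfun_cst _ _).
- by move=> z; have := fM z; rewrite ler_norml => /andP[]; rewrite -lerBlDr sub0r.
have kf1 y : \int[m1]_x (f (x, y) + M) = \int[m1]_x f (x, y) + M.
  by rewrite intD// ?int_cst//; exact: bounded_mfun_cst.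
have kf2 x : \int[m2]_y (f (x, y) + M) = \int[m2]_y f (x, y) + M.
  by rewrite intD// ?int_cst//; exact: bounded_mfun_cst.
have bi1' : bounded_mfun (fun x => \int[m2]_y f (x, y)).
  have -> : (fun x => \int[m2]_y f (x, y)) = (fun x => \int[m2]_y (f (x, y) + M) - M).
    by apply/funext => x; rewrite kf2 addrK.
  exact: bounded_mfunB bi1 (bounded_mfun_cst _ M).
have bi2' : bounded_mfun (fun y => \int[m1]_x f (x, y)).
  have -> : (fun y => \int[m1]_x f (x, y)) = (fun y => \int[m1]_x (f (x, y) + M) - M).
    by apply/funext => x; rewrite kf1 addrK.
  exact: bounded_mfunB bi2 (bounded_mfun_cst _ M).
split => //; move: iE.
rewrite (_ : (fun x => _) = (fun x => \int[m2]_y f (x, y) + M)); last exact/funext.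
rewrite [in RHS](_ : (fun y => _) = (fun y => \int[m1]_x f (x, y) + M)); last exact/funext.
rewrite intD//; last exact: bounded_mfun_cst.
rewrite intD//; last exact: bounded_mfun_cst.
by rewrite !int_cst => /addIr.
Qed.

End fubini.

Section bind_probability.
Context d1 d2 (T1 : measurableType d1) (T2 : measurableType d2) (R : realType).
Variables (nu : probability T1 R) (k : T1 -> probability T2 R).
Hypothesis mk : forall A, measurable A -> measurable_fun setT (fun y => k y A).

Let kg : T1 -> giry T2 R := fun y => k y.
Let mkg : measurable_fun setT kg. Proof. exact: measurable_giry_codensity. Qed.

Definition bind_prob : set T2 -> \bar R := giry_bind nu mkg.

HB.instance Definition _ := Measure.on bind_prob.

Lemma bind_probE A : measurable A -> bind_prob A = (\int[nu]_y k y A)%E.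
Proof.
move=> mA; apply: (@giry_int_map _ _ _ _ _ _ mkg nu (giry_ev ^~ A)) => //.
exact: measurable_giry_ev.
Qed.

Let bind_prob_setT : bind_prob setT = 1%E.
Proof.
rewrite bind_probE//; transitivity (\int[nu]_y 1%:E)%E.
  by apply: eq_integral => y _; exact: probability_setT.
by rewrite integral_cst// mul1e; exact: probability_setT.
Qed.

HB.instance Definition _ := Measure_isProbability.Build _ _ _ bind_prob bind_prob_setT.

End bind_probability.

(** * Uniform laws on time intervals and their behaviour under time shifts *)

Section uniform.
Context (R : realType).
Local Notation leb := (@lebesgue_measure R).

(* Uniform law on [[0, t]] (a junk Dirac mass when [t <= 0]). *)
Definition unif (t : R) : probability (measurableTypeR R) R :=
  match pselect (0 < t) with
  | left t0 => uniform_prob t0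
  | right _ => dirac (0 : measurableTypeR R)
  end.

Lemma bounded_itv_integrable (a b : R) (phi : measurableTypeR R -> R) :
  bounded_mfun phi -> leb.-integrable `[a, b] (EFin \o phi).
Proof.
move=> [mphi [M phiM]]; apply: measurable_bounded_integrable => //.
  + by rewrite /= lebesgue_measure_itv/= lte_fin; case: ifPn; rewrite -?EFinB ltry.
  + exact: measurable_funTS.
  + exists M; split; first exact: num_real.
    by move=> N MN x _ /=; rewrite (le_trans (phiM x))// ltW.
Qed.

Lemma unifE (t : R) (phi : measurableTypeR R -> R) : 0 < t -> bounded_mfun phi ->
  \int[unif t]_s phi s = t^-1 * \int[leb]_(s in `[0, t]) phi s.
Proof.
move=> t0; rewrite /unif; case: pselect => // t0'.
have H (h : measurableTypeR R -> R) : bounded_mfun h -> (forall s, 0 <= h s) ->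
  \int[uniform_prob t0']_s h s = t^-1 * \int[leb]_(s in `[0, t]) h s.
  move=> [mh [M hM]] h0; rewrite /Rintegral integral_uniform//; last first.
    exact/measurable_EFinP.
  rewrite fineM ?subr0//; apply: integrable_fin_num => //.
  by apply: bounded_itv_integrable; split => //; exists M.
move=> bphi; have [mphi [M phiM]] := bphi.
have bi := @bounded_itv_integrable 0 t _ bphi.
have bc := @bounded_itv_integrable 0 t _ (bounded_mfun_cst _ M).
have := H (fun s => phi s + M).
rewrite intD// ?int_cst; last exact: bounded_mfun_cst.
rewrite RintegralD// Rintegral_cst//= lebesgue_measure_itv/= lte_fin t0/= subr0.
rewrite mulrDr [X in _ -> _ -> _ = _ + X]mulrCA mulVf ?gt_eqF// mulr1 => HH.
apply: (addIr M); apply: HH.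
  exact: bounded_mfunD (bounded_mfun_cst _ _).
by move=> z; have := phiM z; rewrite ler_norml => /andP[]; rewrite -lerBlDr sub0r.
Qed.

Lemma unif_eq (t : R) (phi psi : measurableTypeR R -> R) : 0 < t ->
  bounded_mfun phi -> bounded_mfun psi ->
  (forall s, 0 <= s <= t -> phi s = psi s) ->
  \int[unif t]_s phi s = \int[unif t]_s psi s.
Proof.
move=> t0 bphi bpsi e; rewrite !unifE//; congr (_ * _).
by apply: eq_Rintegral => s; rewrite inE/= in_itv/= => /e.
Qed.

Lemma unif_norm_le (t : R) (phi : measurableTypeR R -> R) (C : R) : 0 < t ->
  0 <= C -> bounded_mfun phi -> (forall s, 0 <= s <= t -> `|phi s| <= C) ->
  `|\int[unif t]_s phi s| <= C.
Proof.
move=> t0 C0 bphi phiC.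
have mI : measurable (`[0, t] : set (measurableTypeR R)) by exact: measurable_itv.
(* The bound is known on [[0, t]] only; cutting [phi] off outside makes it global without changing
   the integral. *)
pose psi : measurableTypeR R -> R := fun s => phi s * \1_`[0, t] s.
have psiC s : `|psi s| <= C.
  rewrite /psi indicE; case: (boolP (s \in _)); last by rewrite mulr0 normr0.
  by rewrite inE/= in_itv/= mulr1 => /phiC.
have mpsi : measurable_fun setT psi.
  by apply: measurable_funM; [exact: bphi.1|exact: measurable_indic].
rewrite (@unif_eq _ _ psi)//; first exact: int_norm_le.
  by split => //; exists C.
by move=> s st; rewrite /psi indicE mem_set ?mulr1//= in_itv.
Qed.

Definition translation (s : R) : measurableTypeR R -> measurableTypeR R :=
  fun r => r + s.

Lemma measurable_translation (s : R) : measurable_fun setT (translation s).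
Proof. by apply: measurable_funD => //; exact: measurable_id. Qed.

HB.instance Definition _ (s : R) :=
  isMeasurableFun.Build _ _ _ _ (translation s) (measurable_translation s).

Lemma lebesgue_measure_translation (s : R) (A : set (measurableTypeR R)) : measurable A ->
  pushforward leb (translation s) A = leb A.
Proof.
move=> mA; apply/esym/lebesgue_measure_unique => //= _ [[a b]] _ <-.
rewrite /pushforward/= (_ : _ @^-1` _ = `]a - s, b - s]%classic); last first.
  by apply/seteqP; split => x /=; rewrite !in_itv/= ltrBlDr lerBrDr.
rewrite !lebesgue_measure_itv/= !lte_fin ltrD2r; case: ifPn => // _.
by rewrite -!EFinB opprB addrA subrK.
Qed.

(** The windows [[0, t]] and [[s, t + s]] both lie in [[0, t + s]], and each together with one end
    interval of length [s] covers it. Since [h = phi + C] takes values in [[0, 2 * C]], such an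
    interval contributes at most [2 * C * s]. No comparison of [s] with [t] is needed. *)
Lemma unif_shift (t s C : R) (phi : measurableTypeR R -> R) : 0 < t -> 0 <= s ->
  measurable_fun setT phi -> (forall r, `|phi r| <= C) ->
  `|\int[unif t]_r phi (translation s r) - \int[unif t]_r phi r| <= 2 * C * s / t.
Proof.
move=> t0 s0 mphi phiC.
pose h r := phi r + C.
have h0 r : 0 <= h r.
  by have := phiC r; rewrite ler_norml => /andP[]; rewrite -lerBlDr sub0r.
have h2C r : h r <= 2 * C.
  have := phiC r; rewrite ler_norml => /andP[_]; rewrite /h; lra.
have mh : measurable_fun setT h by exact: measurable_funD.
have ms := measurable_translation s.
have bphi : bounded_mfun phi by split => //; exists C.
have bh : bounded_mfun h by apply: bounded_mfunD => //; exact: bounded_mfun_cst.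
have bphis : bounded_mfun (phi \o translation s).
  by split; [exact: measurableT_comp|exists C => r; exact: phiC].
have bhs : bounded_mfun (h \o translation s).
  by apply: (bounded_mfunD bphis); exact: bounded_mfun_cst.
pose J (a b : R) := (\int[leb]_(r in `[a, b]) (h r)%:E)%E.
have hE0 r : (0 <= (h r)%:E)%E by rewrite lee_fin.
have mhE D : measurable_fun D (fun r => (h r)%:E) by exact/measurable_EFinP/measurable_funTS.
have JD a b c : a <= b -> b <= c -> (J a c <= J a b + J b c)%E.
  move=> ab bc; rewrite /J (@le_trans _ _ (\int[leb]_(r in `[a, b] `|` `]b, c]) (h r)%:E)%E)//.
    apply: ge0_subset_integral => //; first exact: measurableU.
    by move=> r /=; rewrite !in_itv/=; case: (leP r b) => rb /andP[-> ->]; [left|right].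
  rewrite ge0_integral_setU//; last first.
    apply/disj_setPS => r []/=; rewrite !in_itv/= => /andP[_ rb] /andP[br _].
    by move: (lt_le_trans br rb); rewrite ltxx.
  rewrite leeD2l//; apply: ge0_subset_integral => //.
  by move=> r /=; rewrite !in_itv/= => /andP[/ltW -> ->].
have JC a b : a <= b -> (J a b <= (2 * C * (b - a))%:E)%E.
  move=> ab; rewrite /J (@le_trans _ _ (\int[leb]_(r in `[a, b]) (2 * C)%:E)%E)//.
    by apply: ge0_le_integral => // r _; rewrite lee_fin.
  rewrite integral_cst//= lebesgue_measure_itv/= lte_fin.
  case: ifPn => _; first by rewrite -EFinB -EFinM.
  by rewrite mule0 lee_fin mulr_ge0 ?subr_ge0// (le_trans (h0 0)).
have JS a b c e : a <= b -> c <= e -> (J b c <= J a e)%E.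
  move=> ab ce; apply: ge0_subset_integral => //.
  by move=> r /=; rewrite !in_itv/= => /andP[/(le_trans ab) -> /le_trans ->].
have JE : (\int[leb]_(r in `[0%R, t]) (h (translation s r))%:E = J s (t + s)%R)%E.
  rewrite /J (_ : `[0, t]%classic = translation s @^-1` `[s, t + s]%classic); last first.
    by apply/seteqP; split => r /=; rewrite !in_itv/= lerD2r lerDr.
  rewrite -(@ge0_integral_pushforward _ _ _ _ R _ ms leb _ (EFin \o h))//; last by move=> r _; rewrite lee_fin.
  by apply: eq_measure_integral => A mA _; exact/lebesgue_measure_translation.
have Jfin a b : a <= b -> J a b \is a fin_num.
  move=> ab; rewrite ge0_fin_numE ?integral_ge0//.
  by rewrite (le_lt_trans (JC _ _ ab))// ltry.
rewrite [X in `|X|](_ : _ = t^-1 * (fine (J s (t + s)) - fine (J 0 t))); last first.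
  rewrite -[fine (J 0 t)]/(\int[leb]_(r in `[0, t]) h r) -JE.
  rewrite -[fine _]/(\int[leb]_(r in `[0, t]) h (translation s r)).
  rewrite mulrBr -!unifE// !intD//; try exact: bounded_mfun_cst.
  by rewrite !int_cst opprD addrACA subrr addr0.
rewrite normrM gtr0_norm ?invr_gt0// mulrC ler_wpM2r ?invr_ge0 ?(ltW t0)//.
have st : s <= t + s by rewrite lerDr ltW.
have ts : t <= t + s by rewrite lerDl.
have e1 : fine (J 0 t) <= fine (J s (t + s)) + 2 * C * s.
  rewrite -lee_fin EFinD !fineK ?Jfin ?(ltW t0)//.
  rewrite (le_trans (JS 0 0 t (t + s) _ _))// (le_trans (JD 0 s (t + s) _ _))//.
  by rewrite addeC leeD2l// (le_trans (JC _ _ _))// subr0.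
have e2 : fine (J s (t + s)) <= fine (J 0 t) + 2 * C * s.
  rewrite -lee_fin EFinD !fineK ?Jfin ?(ltW t0)//.
  rewrite (le_trans (JS 0 s (t + s) (t + s) _ _))// (le_trans (JD 0 t (t + s) _ _)) ?(ltW t0)//.
  by rewrite leeD2l// (le_trans (JC _ _ _))// addrAC subrr add0r.
by rewrite ler_norml; apply/andP; split; lra.
Qed.

End uniform.

(** * Continuous and Lipschitz functions on a metric space *)

Section metric_functions.
Context (R : realType) (X : pointedType) (rho : X -> X -> R).
Hypothesis rhoM : is_metric rho.
Implicit Types (f g : X -> R) (x y z : X).

Lemma rho_ge0 x y : 0 <= rho x y. Proof. by case: rhoM. Qed.

Lemma rho_xx x : rho x x = 0.
Proof. by case: rhoM => _ h _ _; exact/h. Qed.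

Lemma rhoC x y : rho x y = rho y x. Proof. by case: rhoM. Qed.

Lemma rho_triangle y x z : rho x z <= rho x y + rho y z.
Proof. by case: rhoM. Qed.

(** [X] is only pointed and carries no topology; this filter makes the calculus of limits available
    for [rho]. *)
Definition rho_nbhs x : set_system X :=
  filter_from [set d : R | 0 < d] (rball rho x).

Instance rho_nbhs_filter x : ProperFilter (rho_nbhs x).
Proof.
apply: filter_from_proper; last first.
  by move=> d /= d0; exists x; rewrite /rball/= rho_xx.
apply: filter_from_filter; first by exists 1 => /=.
move=> d e /= d0 e0; exists (Num.min d e); first by rewrite /= lt_min d0.
by move=> y; rewrite /rball/= lt_min => /andP[].
Qed.

Lemma rho_continuousP f :
  rho_continuous rho f <-> forall x, f @ rho_nbhs x --> f x.
Proof.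
split=> h x; first apply/cvgrPdist_lt => e e0.
  by have [d d0 hd] := h x _ e0; exists d.
by move=> e e0; have /cvgrPdist_lt/(_ _ e0)[d d0 hd] := h x; exists d.
Qed.

(** Used to prove that Cesaro averages are Feller: bounded convergence yields continuity along
    sequences. *)
Lemma cont_seq f : (forall x (u : nat -> X), u @ \oo --> rho_nbhs x ->
    f (u n) @[n --> \oo] --> f x) -> rho_continuous rho f.
Proof.
move=> h x e e0; apply: contrapT => /forall2NP hN.
have hN' n : {y | rho x y < n.+1%:R^-1 /\ e <= `|f x - f y|}.
  apply: cid; have [|/existsNP[y /not_implyP[xy fxy]]] := hN n.+1%:R^-1.
    by move=> /negP; rewrite invr_gt0 ltr0n.
  by exists y; split=> //; rewrite leNgt; exact/negP.
pose u n := sval (hN' n).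
have ux : u @ \oo --> rho_nbhs x.
  move=> A [d d0 dA]; have : \forall n \near \oo, n.+1%:R^-1 < d.
    exact: near_infty_natSinv_lt (PosNum d0).
  apply: filterS => n nd; apply: dA; rewrite /rball/=.
  by apply: lt_trans nd; rewrite /u; case: (hN' n) => y [].
have /cvgrPdist_lt/(_ _ e0)[N _ /(_ N (leqnn N))] := h x u ux.
by rewrite ltNge /u; case: (hN' N) => y [_] /= ->.
Qed.

Lemma rho_continuous_seq f x (u : nat -> X) : rho_continuous rho f ->
  u @ \oo --> rho_nbhs x -> f (u n) @[n --> \oo] --> f x.
Proof. by move=> /rho_continuousP/(_ x) fx ux; exact: cvg_trans (cvg_app f ux) fx. Qed.

Notation Cb := (bounded_continuous rho).

Lemma Cb_cst c : Cb (fun=> c).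
Proof.
split; first by exists `|c|.
by apply/rho_continuousP => x; exact: cvg_cst.
Qed.

Lemma CbD f g : Cb f -> Cb g -> Cb (fun x => f x + g x).
Proof.
move=> [[M fM] /rho_continuousP cf] [[N gN] /rho_continuousP cg]; split.
  by exists (M + N) => x; rewrite (le_trans (ler_normD _ _))// lerD.
by apply/rho_continuousP => x; apply: cvgD.
Qed.

Lemma CbM f g : Cb f -> Cb g -> Cb (fun x => f x * g x).
Proof.
move=> [[M fM] /rho_continuousP cf] [[N gN] /rho_continuousP cg]; split.
  by exists (M * N) => x; rewrite normrM ler_pM.
by apply/rho_continuousP => x; apply: cvgM.
Qed.

Lemma CbZ c f : Cb f -> Cb (fun x => c * f x).
Proof. by move=> cf; exact: CbM (Cb_cst _) cf. Qed.

Lemma CbN f : Cb f -> Cb (fun x => - f x).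
Proof.
move=> /(CbZ (-1)); rewrite (_ : (fun x => -1 * _) = (fun x => - f x))//.
by apply/funext => x; rewrite mulN1r.
Qed.

Lemma CbB f g : Cb f -> Cb g -> Cb (fun x => f x - g x).
Proof. by move=> cf cg; exact: CbD cf (CbN cg). Qed.

Lemma Cb_norm f : Cb f -> Cb (fun x => `|f x|).
Proof.
move=> [[M fM] /rho_continuousP cf]; split.
  by exists M => x; rewrite normr_id.
by apply/rho_continuousP => x; apply: cvg_norm.
Qed.

Lemma Cb_max f g : Cb f -> Cb g -> Cb (fun x => Num.max (f x) (g x)).
Proof.
move=> cf cg; rewrite (_ : (fun x => _) =
    (fun x => 2^-1 * (f x + g x + `|f x - g x|))).
  exact/CbZ/(CbD (CbD cf cg))/Cb_norm/CbB.
by apply/funext => x; rewrite maxr_absE mulrC.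
Qed.

Lemma Cb_min f g : Cb f -> Cb g -> Cb (fun x => Num.min (f x) (g x)).
Proof.
move=> cf cg; rewrite (_ : (fun x => _) =
    (fun x => 2^-1 * (f x + g x - `|f x - g x|))).
  exact/CbZ/(CbB (CbD cf cg))/Cb_norm/CbB.
by apply/funext => x; rewrite minr_absE mulrC.
Qed.

Lemma lip_intro L f : (forall x y, f x <= f y + L * rho x y) -> lipschitz_fun rho f.
Proof.
move=> h; exists L => x y; rewrite ler_norml lerBlDl h lerNl opprB lerBlDl.
by rewrite rhoC h.
Qed.

Lemma lip_Cb f : bounded_lipschitz rho f -> Cb f.
Proof.
(* Nothing forces [L] to be positive, hence the denominator [|L| + 1]. *)
move=> [bf [L fL]]; split=> // x e e0; exists (e / (`|L| + 1)).
  by rewrite divr_gt0// ltr_wpDl.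
move=> y; rewrite ltr_pdivlMr ?ltr_wpDl// => xy.
rewrite (le_lt_trans (fL x y))// (le_lt_trans _ xy)// mulrC ler_wpM2l ?rho_ge0//.
by rewrite (le_trans (ler_norm _))// lerDl.
Qed.

Lemma rball_open x e : rho_open rho (rball rho x e).
Proof.
move=> y xy; exists (e - rho x y); first by rewrite subr_gt0.
by move=> z; rewrite /rball/= ltrBrDl; apply: le_lt_trans; exact: rho_triangle.
Qed.

Lemma cont_open f a : rho_continuous rho f -> rho_open rho [set x | a < f x].
Proof.
move=> cf x /= ax; have [|d d0 h] := cf x (f x - a); first by rewrite subr_gt0.
exists d => // y /h; rewrite ltr_norml => /andP[_] /=; lra.
Qed.

Lemma cont_open_lt f a : rho_continuous rho f -> rho_open rho [set x | f x < a].
Proof.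
move=> cf x /= xa; have [|d d0 h] := cf x (a - f x); first by rewrite subr_gt0.
exists d => // y /h; rewrite ltr_norml => /andP[+ _] /=; lra.
Qed.

Lemma rho_open_measurable (A : set (Borel rho)) : rho_open rho A -> measurable A.
Proof. by move=> oA; exact: sub_sigma_algebra. Qed.

Lemma rball_measurable x e : measurable (rball rho x e : set (Borel rho)).
Proof. exact: (@rho_open_measurable _ (@rball_open x e)). Qed.

Lemma Cb_mfun f : Cb f -> bounded_mfun (f : Borel rho -> R).
Proof.
move=> [[M fM] cf]; split; last by exists M.
apply: (measurability _ (RGenOInfty.measurableE R)) => //.
move=> _ [_ [a ->] <-]; rewrite setTI; apply: rho_open_measurable.
have := cont_open (a := a) cf; congr (rho_open _ _).
by apply/seteqP; split => x /=; rewrite in_itv/= andbT.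
Qed.

(* Inf-convolution with [k * rho]. *)
Lemma lip_approx f : (forall x, 0 <= f x <= 1) ->
  (forall x (e : R), 0 < e ->
    exists2 d : R, 0 < d & forall y, rho x y < d -> f x - e < f y) ->
  exists g : nat -> X -> R, [/\ forall k, bounded_lipschitz rho (g k),
    forall k x, 0 <= g k x <= f x, forall k x, g k x <= g k.+1 x &
    forall x, g k x @[k --> \oo] --> f x].
Proof.
move=> f01 lf; pose S k x := [set f y + k%:R * rho x y | y in [set: X]].
pose g k x := inf (S k x).
have Sge0 k x b : S k x b -> 0 <= b.
  move=> [y _ <-]; have /andP[fy0 _] := f01 y.
  by rewrite addr_ge0// mulr_ge0// rho_ge0.
have Slb k x : has_lbound (S k x) by exists 0 => b /Sge0.
have S0 k x : S k x !=set0 by exists (f x + k%:R * rho x x); exists x.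
have gle k x y : g k x <= f y + k%:R * rho x y by apply: ge_inf => //; exists y.
have gf k x : g k x <= f x by rewrite (le_trans (gle k x x))// rho_xx mulr0 addr0.
have g0 k x : 0 <= g k x by apply: lb_le_inf => // b /Sge0.
exists g; split=> [k|k x|k x|x]; last 3 first.
- by rewrite g0 gf.
- apply: lb_le_inf => // _ [y _ <-]; rewrite (le_trans (gle k x y))// lerD2l.
  by rewrite ler_wpM2r ?rho_ge0// ler_nat.
- apply/cvgrPdist_le => e e0; have [d d0 hd] := lf x _ e0.
  have : \forall k \near \oo, d^-1 <= k%:R.
    exact: nbhs_infty_ger.
  apply: filterS => k dk; rewrite ger0_norm ?subr_ge0// lerBlDl -lerBlDr.
  (* Points closer than [d] are handled by lower semicontinuity; beyond [d] the penalty is at least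
     [k d >= 1 >= f x]. *)
  apply: lb_le_inf => // _ [y _ <-]; have [xy|xy] := ltP (rho x y) d.
    rewrite (le_trans (ltW (hd _ xy)))// lerDl mulr_ge0// rho_ge0//.
  have /andP[fy0 _] := f01 y; have /andP[_ fx1] := f01 x.
  suff : 1 <= k%:R * rho x y by lra.
  have : d^-1 * d <= k%:R * rho x y by rewrite ler_pM// ?invr_ge0 ltW.
  by rewrite mulVf// gt_eqF.
split.
  exists 1 => x; rewrite ger0_norm// (le_trans (gf _ _))//.
  by have /andP[] := f01 x.
apply: (@lip_intro k%:R) => x y; rewrite -lerBlDr.
apply: lb_le_inf => // _ [w _ <-]; rewrite lerBlDr (le_trans (gle _ _ w))//.
by rewrite -addrA lerD2l -mulrDr ler_wpM2l// addrC rho_triangle.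
Qed.

(** A trapezoid: 1 up to distance [r / 2] from [c], then slope [2 / r] down to 0 at distance [r]. *)
Definition tent (c : X) (r : R) x := Num.min 1 (Num.max 0 (2 - 2 / r * rho c x)).

Lemma tent_ge0 c r x : 0 <= tent c r x.
Proof. by rewrite /tent le_min ler01 le_max lexx. Qed.

Lemma tent_le1 c r x : tent c r x <= 1.
Proof. by rewrite /tent ge_min lexx. Qed.

Lemma tent1 c r x : 0 < r -> rho c x <= r / 2 -> tent c r x = 1.
Proof.
move=> r0 cx; rewrite /tent; apply/min_idPl; rewrite le_max; apply/orP; right.
rewrite lerBrDr -lerBrDl (_ : 2 - 1 = 1); last lra.
by rewrite mulrAC ler_pdivrMr// mul1r -ler_pdivlMl// mulrC.
Qed.

Lemma tent0 c r x : 0 < r -> r <= rho c x -> tent c r x = 0.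
Proof.
move=> r0 cx; rewrite /tent (max_idPl _) ?(min_idPr _)//.
by rewrite subr_le0 mulrAC ler_pdivlMr// ler_pM2l.
Qed.

Lemma tent_lip c r x y : 0 < r -> tent c r x <= tent c r y + 2 / r * rho x y.
Proof.
move=> r0; have h : 2 / r * rho c y <= 2 / r * rho c x + 2 / r * rho x y.
  by rewrite -mulrDr ler_pM2l ?divr_gt0// rho_triangle.
have : 0 <= 2 / r * rho x y by rewrite mulr_ge0 ?rho_ge0// divr_ge0// ltW.
move: h; rewrite /tent.
move: (2 / r * rho c y) (2 / r * rho c x) (2 / r * rho x y) => a b l abl l0.
have [a0|a0] := lerP 0 (2 - a); have [b0|b0] := lerP 0 (2 - b);
  rewrite ?(min_r ler01); try lra.
- by case: (lerP 1 (2 - a)); case: (lerP 1 (2 - b)); lra.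
- by case: (lerP 1 (2 - a)); lra.
- by case: (lerP 1 (2 - b)); lra.
Qed.

Lemma tent_bounded_lip c r : 0 < r -> bounded_lipschitz rho (tent c r).
Proof.
move=> r0; split.
  by exists 1 => x; rewrite ger0_norm ?tent_ge0// tent_le1.
by apply: (@lip_intro (2 / r)) => x y; exact: tent_lip.
Qed.

Lemma tent_le_indic c r x : 0 < r -> tent c r x <= \1_(rball rho c r) x.
Proof.
move=> r0; rewrite indicE; case: (boolP (x \in _)) => [_|]; first exact: tent_le1.
by rewrite notin_setE /rball/= => /negP; rewrite -leNgt => /(tent0 r0) ->.
Qed.

Lemma indic_le_tent c r x : 0 < r -> \1_(rball rho c (r / 2)) x <= tent c r x.
Proof.
move=> r0; rewrite indicE; case: (boolP (x \in _)) => [|_]; last exact: tent_ge0.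
by rewrite inE /rball/= => /ltW/(tent1 r0) ->.
Qed.

Section tents.
Variables (u : nat -> X) (r : R).
Hypothesis r0 : 0 < r.

(** A supremum instead of a sum: it stays in [[0, 1]] and keeps the Lipschitz constant [2 / r] for
    every [J], finite or not. For empty [J] the supremum is 0, the right value. *)
Definition tents (J : set nat) x := sup [set tent (u k) r x | k in J].

Lemma tents_le J x b : 0 <= b -> (forall k, J k -> tent (u k) r x <= b) ->
  tents J x <= b.
Proof.
move=> b0 h; have [->|/set0P[k Jk]] := eqVneq J set0.
  by rewrite /tents image_set0 sup0.
by apply: sup_le_ub; [exists (tent (u k) r x), k|move=> _ [j Jj <-]; exact: h].
Qed.

Lemma le_tents J x k : J k -> tent (u k) r x <= tents J x.
Proof.
move=> Jk; apply: ub_le_sup; last by exists k.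
by exists 1 => _ [j _ <-]; exact: tent_le1.
Qed.

Lemma tents_ge0 J x : 0 <= tents J x.
Proof.
have [->|/set0P[k Jk]] := eqVneq J set0; first by rewrite /tents image_set0 sup0.
exact: le_trans (tent_ge0 _ _ _) (le_tents x Jk).
Qed.

Lemma tents_le1 J x : tents J x <= 1.
Proof. by apply: tents_le => // k _; exact: tent_le1. Qed.

Lemma tents_bounded_lip J : bounded_lipschitz rho (tents J).
Proof.
split; first by exists 1 => x; rewrite ger0_norm ?tents_ge0// tents_le1.
apply: (@lip_intro (2 / r)) => x y; apply: tents_le.
  by rewrite addr_ge0 ?tents_ge0// mulr_ge0 ?rho_ge0// divr_ge0// ltW.
move=> k Jk; rewrite (le_trans (tent_lip _ _ y _))// lerD2r; exact: le_tents.
Qed.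

Lemma le_tentsS J K x : J `<=` K -> tents J x <= tents K x.
Proof.
by move=> JK; apply: tents_le => [|k /JK]; [exact: tents_ge0|exact: le_tents].
Qed.

Lemma tentsU J K x : tents (J `|` K) x <= tents J x + tents K x.
Proof.
apply: tents_le => [|k [Jk|Kk]]; first by rewrite addr_ge0 ?tents_ge0.
  by rewrite (le_trans (le_tents x Jk))// lerDl tents_ge0.
by rewrite (le_trans (le_tents x Kk))// lerDr tents_ge0.
Qed.

(** With centres [2 * r] apart the open balls of radius [r] are disjoint, so at each point one of
    the two families of tents vanishes. *)
Definition far_apart (J K : set nat) :=
  forall j k, J j -> K k -> 2 * r <= rho (u j) (u k).

Lemma tents_eq0 J x : (forall k, J k -> r <= rho (u k) x) -> tents J x = 0.
Proof.
move=> h; apply/eqP; rewrite eq_le tents_ge0 andbT.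
by apply: tents_le => // k /h /(tent0 r0) ->.
Qed.

Lemma tents_far_apart J K x : far_apart J K -> tents J x = 0 \/ tents K x = 0.
Proof.
move=> JK; have [/existsNP[j /not_implyP[Jj /negP]]|] :=
    pselect (~ forall k, J k -> r <= rho (u k) x); last first.
  by move=> /contrapT/tents_eq0; left.
rewrite -ltNge => jx; right; apply: tents_eq0 => k Kk.
have := JK _ _ Jj Kk; have := rho_triangle x (u j) (u k).
rewrite (rhoC x); lra.
Qed.

Lemma tentsU_far_apart J K x : far_apart J K ->
  tents J x + tents K x <= tents (J `|` K) x.
Proof.
move=> /(@tents_far_apart _ _ x)[->|->]; rewrite ?add0r ?addr0; apply: le_tentsS.
  exact: subsetUr.
exact: subsetUl.
Qed.

End tents.

(** Open sets are stable under intersection and generate the Borel sets. The indicator of an open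
    set is lower semicontinuous, hence a limit of Lipschitz functions by [lip_approx], and bounded
    convergence gives equality on open sets. *)
Lemma probability_lip_unique (mu nu : probability (Borel rho) R) :
  (forall f, bounded_lipschitz rho f ->
     \int[mu]_(x in [set: Borel rho]) f x = \int[nu]_(x in [set: Borel rho]) f x) ->
  forall A : set (Borel rho), measurable A -> mu A = nu A.
Proof.
move=> h A mA.
apply: (@g_sigma_algebra_measure_unique _ R (Borel rho) (rho_open rho) _
  (fun=> setT)) => //.
- by move=> B; exact: rho_open_measurable.
- by move=> _ x _; exists 1.
- by rewrite bigcup_const//; exists 0%N.
- move=> B C oB oC x [/oB[b b0 hb] /oC[c c0 hc]].
  exists (Num.min b c); first by rewrite lt_min b0.
  by move=> y; rewrite /rball/= lt_min => /andP[/hb ? /hc].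
- move=> B oB; have mB := rho_open_measurable oB.
  have [||g [gl g01 _ gB]] := @lip_approx (\1_B : X -> R).
  + by move=> x; rewrite indicE; case: (_ \in _); rewrite ?lexx ?ler01.
  + move=> x e e0; rewrite indicE; case: (boolP (x \in B)).
      rewrite inE => /oB[d d0 dB]; exists d => // y /dB By.
      by rewrite indicE mem_set//= gtrBl.
    by move=> _; exists 1 => // y _; rewrite sub0r indicE (lt_le_trans (y := 0))// oppr_lt0.
  have E : fine (mu B) = fine (nu B).
    have cv (m : probability (Borel rho) R) :
        \int[m]_(x in [set: Borel rho]) g k x @[k --> \oo] --> fine (m B).
      rewrite -int_indic//; apply: (@int_cvg _ _ _ m _ _ 1) => //.
      + by move=> k; have [] := Cb_mfun (lip_Cb (gl k)).
      + move=> k x; have /andP[g0 gf] := g01 k x.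
        rewrite ger0_norm// (le_trans gf)// indicE; case: (x \in B).
    have c1 := cv mu; have c2 := cv nu.
    apply: cvg_unique c1 _ => //.
    by rewrite (_ : (fun k => _) = (fun k => \int[nu]_(x in [set: Borel rho]) g k x))//;
      apply/funext => k; exact: h.
  by rewrite -[LHS]fineK ?fin_num_measure// E fineK// fin_num_measure.
- by move=> _; rewrite (le_lt_trans (probability_le1 mu measurableT))// ltry.
Qed.

End metric_functions.

Arguments rho_open_measurable [R X rho A] _ : rename.
Arguments rball_open [R X rho] _ x e.

(** * Cesaro averages of a Markov-Feller semigroup *)

Section caratheodory_function.
Context (R : realType) (X : pointedType) (rho : X -> X -> R).
Hypothesis rhoM : is_metric rho.
Variable u : nat -> X.
Hypothesis u_dense : forall x (e : R), 0 < e -> exists n, rho x (u n) < e.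

(* Joint measurability: [g s y] is the limit of [g s (u k)] where [k] is the
   first index with [rho y (u k) < 1/n]. *)
Lemma caratheodory_measurable d (T : measurableType d) (g : T -> X -> R) :
  (forall y, measurable_fun setT (fun s => g s y)) ->
  (forall s, rho_continuous rho (g s)) ->
  measurable_fun setT (fun p : T * Borel rho => g p.1 p.2).
Proof.
move=> mg cg.
have ex n y : exists k, `[< rho (u k) y < n.+1%:R^-1 >].
  have n0 : 0 < n.+1%:R^-1 :> R by rewrite invr_gt0.
  by have [k hk] := u_dense y n0; exists k; apply/asboolP; rewrite (rhoC rhoM).
pose kn n y := ex_minn (ex n y).
have mk n k : measurable ([set y | kn n y = k] : set (Borel rho)).
  rewrite (_ : [set _ | _] = rball rho (u k) n.+1%:R^-1 `\`
      \bigcup_(j in `I_k) rball rho (u j) n.+1%:R^-1).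
    apply: measurableD; first exact: rball_measurable.
    by apply: bigcup_measurable => j _; exact: rball_measurable.
  apply/seteqP; split => y /=.
    rewrite /kn; case: ex_minnP => m /asboolP hm min <-; split => // -[j /= jm hj].
    by have := min j; rewrite leqNgt jm => h; have := h (asboolT hj).
  move=> [yk nj]; rewrite /kn; case: ex_minnP => m /asboolP hm min.
  apply/eqP; rewrite eqn_leq min ?asboolT// leqNgt; apply/negP => mk.
  by apply: nj; exists m.
apply: (@measurable_fun_cvg _ _ _ _ (fun n (p : T * Borel rho) => g p.1 (u (kn n p.2)))).
  move=> n _ V mV; rewrite setTI.
  rewrite (_ : _ @^-1` V = \bigcup_k
      ([set s | V (g s (u k))] `*` [set y | kn n y = k])); last first.
    apply/seteqP; split => [[s y] /= h|[s y] [k _ [/= h e]]]; last by rewrite e.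
    by exists (kn n y).
  apply: bigcupT_measurable => k; apply: measurableX => //.
  by have := mg (u k) measurableT V mV; rewrite setTI.
move=> [s y] _ /=; apply: (rho_continuous_seq rhoM (cg s)).
move=> A [e e0 eA]; have : \forall n \near \oo, n.+1%:R^-1 < e.
  exact: near_infty_natSinv_lt (PosNum e0).
apply: filterS => n ne; apply: eA; rewrite /rball/=; apply: lt_trans ne.
by rewrite /kn (rhoC rhoM); case: ex_minnP => m /asboolP.
Qed.

End caratheodory_function.

Section markov.
Context (R : realType) (X : pointedType) (rho : X -> X -> R).
Hypothesis rhoM : is_metric rho.
Variable P : R -> X -> probability (Borel rho) R.
Hypothesis PM : markov_feller_semigroup P.
Variable u : nat -> X.
Hypothesis u_dense : forall x (e : R), 0 < e -> exists n, rho x (u n) < e.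
Notation Cb := (bounded_continuous rho).
Implicit Types (f : X -> R) (x y : X) (s t : R).
Local Notation leb := (@lebesgue_measure R).

Let mPx t (t0 : 0 <= t) : forall A : set (Borel rho), measurable A ->
  measurable_fun setT (fun x : Borel rho => P t x A).
Proof. by move=> A mA; have [h _ _ _ _] := PM; exact: h. Qed.

(* [P s] is meaningful for [0 <= s] only; [fun s => P `|s| x] is a kernel on the
   whole line. *)
Let mPt x : forall A : set (Borel rho), measurable A ->
  measurable_fun setT (fun s : measurableTypeR R => P `|s| x A).
Proof.
move=> A mA; have [_ _ _ _ /(_ x A mA) h] := PM.
apply: (@measurable_comp _ _ _ (measurableTypeR R) (measurableTypeR R) _
  `[0%R, +oo[%classic (fun s => P s x A) setT (@Num.Def.normr R R)) => //.
  by move=> _ [s _ <-] /=; rewrite in_itv/= andbT.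
Qed.

Lemma Pf_norm_le t f x M : bounded_mfun (f : Borel rho -> R) ->
  (forall y, `|f y| <= M) -> `|Pf P t f x| <= M.
Proof. by move=> [mf _] fM; exact: int_norm_le. Qed.

Lemma Pf_mfun t f : 0 <= t -> bounded_mfun (f : Borel rho -> R) ->
  bounded_mfun (Pf P t f : Borel rho -> R).
Proof.
move=> t0 bf.
(* Only the measurability half of [int_bind] is wanted, which does not depend on the base law;
   [P 0 point] is an arbitrary choice. *)
have [] // := @int_bind _ _ _ _ _ (P 0 point) (P t)
  (bind_prob (P 0 point) (mPx t0)) f (mPx t0).
by move=> A mA; exact: bind_probE.
Qed.

Lemma Pf_time_mfun f x : bounded_mfun (f : Borel rho -> R) ->
  bounded_mfun (fun s : measurableTypeR R => Pf P `|s| f x).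
Proof.
move=> bf; have [] // := @int_bind _ _ _ _ _ (unif 1) (fun s => P `|s| x)
  (bind_prob (unif 1) (mPt x)) f (mPt x).
by move=> A mA; exact: bind_probE.
Qed.

Lemma PfD s t f x : 0 <= s -> 0 <= t -> bounded_mfun (f : Borel rho -> R) ->
  Pf P (s + t) f x = Pf P s (Pf P t f) x.
Proof.
move=> s0 t0 bf.
have [] // := @int_bind _ _ _ _ _ (P s x) (P t) (P (s + t) x) f (mPx t0).
by move=> A mA; have [_ _ h _ _] := PM; exact: h.
Qed.

Lemma Pf_Cb t f : 0 <= t -> Cb f -> Cb (Pf P t f).
Proof.
move=> t0 cf; split; last by have [_ _ _ h _] := PM; exact: h.
have [[M fM] _] := cf.
by exists M => x; apply: Pf_norm_le => //; exact: Cb_mfun.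
Qed.

(** The law of the process started at [x] and observed at a uniform time in [[0, t]]. Averages
    become integrals against one probability, hence inherit linearity, monotonicity and bounded
    convergence. *)
Definition Qm (t : R) (x : X) : probability (Borel rho) R :=
  bind_prob (unif t) (mPt x).

Lemma QfE t f x : 0 < t -> bounded_mfun (f : Borel rho -> R) ->
  Qf P t f x = \int[unif t]_s Pf P `|s| f x.
Proof.
move=> t0 bf; rewrite (unifE t0 (Pf_time_mfun x bf)).
rewrite /Qf; congr (_ * _); apply: eq_Rintegral => s; rewrite inE/= in_itv/=.
by move=> /andP[s0 _]; rewrite ger0_norm.
Qed.

Lemma Qf_Qm t f x : 0 < t -> bounded_mfun (f : Borel rho -> R) ->
  Qf P t f x = \int[Qm t x]_y f y.
Proof.
move=> t0 bf; rewrite (QfE x t0 bf).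
have [A mA|//|_ ->//] := @int_bind _ _ _ _ _ (unif t) (fun s => P `|s| x) (Qm t x) f (mPt x).
exact: bind_probE.
Qed.

(** Default values: [0^-1 = 0], and the interval is empty for [t < 0]. They make bounds and
    continuity of [Qf] valid for all [t]. *)
Lemma Qf_le0 t f x : t <= 0 -> Qf P t f x = 0.
Proof.
rewrite le_eqVlt /Qf => /predU1P[->|t0]; first by rewrite invr0 mul0r.
by rewrite set_itv_ge ?Rintegral_set0 ?mulr0// bnd_simp -ltNge.
Qed.

Lemma Qf_norm_le t f x M : bounded_mfun (f : Borel rho -> R) ->
  (forall y, `|f y| <= M) -> `|Qf P t f x| <= M.
Proof.
move=> bf fM; have [t0|t0] := leP t 0.
  by rewrite Qf_le0// normr0 (le_trans _ (fM point)).
by rewrite Qf_Qm//; apply: int_norm_le => //; exact: bf.1.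
Qed.

Lemma Qf_Cb t f : Cb f -> Cb (Qf P t f).
Proof.
move=> cf; have bf := Cb_mfun cf; have [[M fM] _] := cf.
have [t0|t0] := leP t 0.
  rewrite (_ : Qf P t f = fun=> 0); first exact: Cb_cst.
  by apply/funext => x; exact: Qf_le0.
split; first by exists M => x; exact: Qf_norm_le.
apply: cont_seq => // x v vx.
rewrite (QfE x t0 bf) (_ : (fun n => _) = (fun n => \int[unif t]_s Pf P `|s| f (v n))).
  apply: (@int_cvg _ _ _ (unif t) _ _ M).
  - by move=> n; have [] := Pf_time_mfun (v n) bf.
  - by move=> n s; exact: Pf_norm_le.
  - move=> s; apply: (rho_continuous_seq rhoM _ vx).
    by have [] := Pf_Cb (normr_ge0 s) cf.
by apply/funext => n; rewrite (QfE _ t0 bf).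
Qed.

(** The semigroup is measurable in time and, by the Feller property, continuous in space; together
    this gives the joint measurability that Fubini requires. *)
Lemma Pf_joint_mfun f : Cb f ->
  bounded_mfun (fun p : measurableTypeR R * Borel rho => Pf P `|p.1| f p.2).
Proof.
move=> cf; have bf := Cb_mfun cf; have [[M fM] _] := cf.
split; last by exists M => p; exact: Pf_norm_le.
apply: (@caratheodory_measurable _ _ _ rhoM u u_dense _ (measurableTypeR R)
  (fun s => Pf P `|s| f)).
  by move=> y; have [] := Pf_time_mfun y bf.
by move=> s; have [] := Pf_Cb (normr_ge0 s) cf.
Qed.

Lemma Qpair_time_mfun (nu : probability (Borel rho) R) f : Cb f ->
  bounded_mfun (fun s : measurableTypeR R => \int[nu]_(x in [set: Borel rho]) Pf P `|s| f x).
Proof. by move=> cf; have [] := int_fubini (unif 1) nu (Pf_joint_mfun cf). Qed.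

Lemma QpairE_unif (nu : probability (Borel rho) R) t f : 0 < t -> Cb f ->
  Qpair P nu t f = \int[unif t]_s \int[nu]_(x in [set: Borel rho]) Pf P `|s| f x.
Proof.
move=> t0 cf; rewrite (unifE t0 (Qpair_time_mfun nu cf)).
apply: (congr1 ( *%R t^-1)); apply: eq_Rintegral => s; rewrite inE/= in_itv/=.
by move=> /andP[s0 _]; rewrite ger0_norm.
Qed.

Lemma QpairE (nu : probability (Borel rho) R) t f : 0 < t -> Cb f ->
  Qpair P nu t f = \int[nu]_(x in [set: Borel rho]) Qf P t f x.
Proof.
move=> t0 cf; rewrite (QpairE_unif nu t0 cf).
have [_ _ /= ->] := int_fubini (unif t) nu (Pf_joint_mfun cf).
by apply: eq_Rintegral => x _; rewrite (QfE x t0 (Cb_mfun cf)).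
Qed.

Lemma Qx_Qm t x (A : set (Borel rho)) : 0 < t -> measurable A ->
  Qx P t x A = fine (Qm t x A).
Proof.
move=> t0 mA; rewrite -int_indic// -Qf_Qm//; last exact: bounded_mfun_indic.
rewrite /Qf /Qx; congr (_ * _); apply: eq_Rintegral => s _.
by rewrite /Pf int_indic.
Qed.

(** Trades a bound on an average for a bound at one time, at which the Markov property can be
    applied. *)
Lemma Qx_gt t x (A : set (Borel rho)) (a : R) : 0 < t -> measurable A ->
  a < Qx P t x A -> exists2 s, 0 <= s & a < fine (P s x A).
Proof.
move=> t0 mA aQ; apply: contrapT => /forall2NP h.
move: aQ; apply/negP; rewrite -leNgt Qx_Qm// -int_indic// -Qf_Qm//; last exact: bounded_mfun_indic.
rewrite QfE//; last exact: bounded_mfun_indic.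
rewrite -[leRHS](int_cst (unif t)); apply: le_int.
- by apply: Pf_time_mfun; exact: bounded_mfun_indic.
- exact: bounded_mfun_cst.
- move=> s; rewrite /Pf int_indic// leNgt; apply/negP => as_.
  by case: (h `|s|) => [/negP|] //; rewrite normr_ge0.
Qed.

Lemma Qf_Pf_shift t s f x M : 0 < t -> 0 <= s -> bounded_mfun (f : Borel rho -> R) ->
  (forall y, `|f y| <= M) ->
  `|Qf P t (Pf P s f) x - Qf P t f x| <= 2 * M * s / t.
Proof.
move=> t0 s0 bf fM; rewrite !QfE//; last exact: Pf_mfun.
have mphi := Pf_time_mfun x bf.
have := @unif_shift R t s M (fun r => Pf P `|r| f x) t0 s0 mphi.1 _.
rewrite (@unif_eq _ t _ (fun r => Pf P `|r| (Pf P s f) x))//.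
- by apply => r; exact: Pf_norm_le.
- split; last by exists M => r; exact: Pf_norm_le.
  by apply: measurableT_comp mphi.1 _; exact: measurable_translation.
- by apply: Pf_time_mfun; exact: Pf_mfun.
- move=> r /andP[r0 _]; rewrite /translation -PfD// ger0_norm ?addr_ge0//.
  by rewrite ger0_norm.
Qed.

(** Fubini under the law [Qm t x] writes [Q_t Q_m f] as the mean over [s] in [[0, m]] of
    [Q_t P_s f], and [Qf_Pf_shift] bounds each error by its value at [s = m]. *)
Lemma Qf_Qf_shift t m f x M : 0 < t -> 0 < m -> Cb f ->
  (forall y, `|f y| <= M) ->
  `|Qf P t (Qf P m f) x - Qf P t f x| <= 2 * M * m / t.
Proof.
move=> t0 m0 cf fM; have bf := Cb_mfun cf.
have bQ := Cb_mfun (Qf_Cb m cf).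
rewrite Qf_Qm// -QpairE// QpairE_unif// -[X in _ - X](int_cst (unif m)) -intB; last 2 first.
- exact: Qpair_time_mfun.
- exact: bounded_mfun_cst.
have M0 : 0 <= M by rewrite (le_trans _ (fM point)).
apply: unif_norm_le => //.
- by rewrite divr_ge0 ?mulr_ge0 ?(ltW t0) ?(ltW m0).
- by apply: bounded_mfunB; [exact: Qpair_time_mfun|exact: bounded_mfun_cst].
- move=> s /andP[s0 sm]; rewrite -Qf_Qm//; last exact: Pf_mfun.
  rewrite (le_trans (Qf_Pf_shift _ _ _ bf fM))//.
  by rewrite ler_pM2r ?invr_gt0// ler_wpM2l ?mulr_ge0// ger0_norm.
Qed.

(** By Fubini the left side averages [P_s P_r f] over [r], and the two semigroup times commute. *)
Lemma Pf_Qf t s f x : 0 < t -> 0 <= s -> Cb f ->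
  Pf P s (Qf P t f) x = Qf P t (Pf P s f) x.
Proof.
move=> t0 s0 cf; have bf := Cb_mfun cf.
transitivity (Qpair P (P s x) t f); first by rewrite (QpairE _ t0 cf).
rewrite (QpairE_unif _ t0 cf) (QfE x t0 (Pf_mfun s0 bf)).
by apply: eq_Rintegral => r _; rewrite -[LHS](PfD x s0 (normr_ge0 r) bf) addrC PfD.
Qed.

End markov.

(** * Asymptotic equality of the averages *)

Section limsup.
Context (R : realType).
Implicit Types (h : R -> R) (a K e : R).
Local Notation limsup h := (limf_esup (fun t => (h t)%:E) (+oo)%R).

Lemma limsup_lt h a : (limsup h < a%:E)%E -> \forall t \near +oo, h t < a.
Proof.
rewrite limf_esupE => /ereal_inf_lt[_ [V FV <-] Va].
apply: filterS FV => t Vt; rewrite -lte_fin (le_lt_trans _ Va)//.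
by apply: ereal_sup_ubound; exists t.
Qed.

Lemma limsup_gt h a : (a%:E < limsup h)%E -> forall t0, exists2 t, t0 < t & a < h t.
Proof.
move=> ah t0; apply: contrapT => /forall2NP hN.
move: ah; apply/negP; rewrite -leNgt limf_esupE.
apply: (@le_trans _ _ (ereal_sup ((fun t => (h t)%:E) @` [set t | t0 < t]))).
  by apply: ereal_inf_lbound; exists [set t | t0 < t] => //; exact/nbhs_pinfty_gt/num_real.
apply: ge_ereal_sup => _ [t /= t0t <-]; rewrite lee_fin leNgt; apply/negP => at_.
by case: (hN t).
Qed.

Lemma limsup_ge h a : (\forall t \near +oo, a <= h t) -> (a%:E <= limsup h)%E.
Proof.
move=> ah; rewrite limf_esupE; apply: le_ereal_inf_tmp => _ [V FV <-].
have [t [Vt at_]] := filter_ex (filterI FV ah).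
apply: (@le_trans _ _ (h t)%:E); first by rewrite lee_fin.
by apply: ereal_sup_ubound; exists t.
Qed.

Lemma limsup_norm_eq0 h : h t @[t --> +oo] --> 0 -> limsup (fun t => `|h t|) = 0%E.
Proof.
move=> /cvgrPdist_le h0; apply/eqP; rewrite eq_le; apply/andP; split; last first.
  by apply: limsup_ge; near=> t.
apply/lee_addgt0Pr => e e0; rewrite add0e limf_esupE.
have {}h0 := h0 e e0.
apply: (@le_trans _ _ (ereal_sup ((fun t => `|h t|%:E) @` [set t | `|0 - h t| <= e]))).
  by apply: ereal_inf_lbound; exists [set t | `|0 - h t| <= e].
by apply: ge_ereal_sup => _ [t /= ht <-]; rewrite lee_fin -normrN -sub0r.
Unshelve. all: by end_near. Qed.

Lemma near_div_le K e : 0 < e -> \forall t \near +oo, K / t <= e.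
Proof.
move=> e0; near=> t.
have t0 : 0 < t by near: t; exact: nbhs_pinfty_gt.
rewrite ler_pdivrMr// mulrC -ler_pdivrMr//; near: t.
Unshelve. all: by end_near. Qed.

Lemma cvg_pinfty_pos_eq (f g : R -> R) (l : R) : (forall t, 0 < t -> f t = g t) ->
  f t @[t --> +oo] --> l -> g t @[t --> +oo] --> l.
Proof.
move=> fg; apply: cvg_trans; apply: near_eq_cvg.
have : \forall t \near +oo, 0 < t :> R by exact: nbhs_pinfty_gt.
by apply: filterS => t; exact: fg.
Qed.

End limsup.

Section asymptotic_equality.
Context (R : realType) (X : pointedType) (rho : X -> X -> R).
Hypothesis rhoM : is_metric rho.
Variable P : R -> X -> probability (Borel rho) R.
Hypothesis PM : markov_feller_semigroup P.
Variable u : nat -> X.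
Hypothesis u_dense : forall x (e : R), 0 < e -> exists n, rho x (u n) < e.
Notation Cb := (bounded_continuous rho).
Notation BL := (bounded_lipschitz rho).
Implicit Types (f : X -> R) (x y z : X) (s t : R).

Let Cb_lip f : BL f -> Cb f. Proof. exact: lip_Cb. Qed.

Lemma cesaro_near z f (eta : R) : cesaro_ev_continuous P z -> BL f -> 0 < eta ->
  exists2 d, 0 < d & forall y, rball rho z d y ->
    \forall t \near +oo, `|Qf P t f y - Qf P t f z| < eta.
Proof.
move=> cz lf eta0; have := cz f lf; rewrite /rho_limsup => i0.
have : (ereal_inf [set ereal_sup ((fun x => limf_esup (fun t =>
  (`|Qf P t f x - Qf P t f z|)%:E) (+oo)%R) @` rball rho z d) | d in [set d : R | (0 < d)%R]]
    < eta%:E)%E by rewrite i0 lte_fin.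
move=> /ereal_inf_lt[_ [d d0 <-]] sd; exists d => // y yd; apply: limsup_lt.
by apply: le_lt_trans sd; apply: ereal_sup_ubound; exists y.
Qed.

Lemma cesaro_intro z :
  (forall f x, BL f -> Qf P t f x - Qf P t f z @[t --> +oo] --> 0) ->
  cesaro_ev_continuous P z.
Proof.
move=> h f lf; rewrite /rho_limsup.
rewrite (_ : (fun x => _) = cst 0%E); last first.
  by apply/funext => x; apply: limsup_norm_eq0; exact: h.
rewrite (_ : [set _ | _ in _] = [set 0%E]) ?ereal_inf1//.
apply/seteqP; split => [_ [d /= d0 <-]|_ ->].
  rewrite (_ : [set _ | _ in _] = [set 0%E]) ?ereal_sup1//.
  apply/seteqP; split => [_ [x _ <-]//|_ ->]; exists z => //.
  by rewrite /rball/= rho_xx.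
exists 1 => //=; rewrite (_ : [set _ | _ in _] = [set 0%E]) ?ereal_sup1//.
apply/seteqP; split => [_ [x _ <-]//|_ ->]; exists z => //.
by rewrite /rball/= rho_xx.
Qed.

Lemma lower_bound z (e : R) :
  (0 < ereal_inf [set limf_esup (fun t => (Qx P t x (rball rho z e))%:E) (+oo)%R
                 | x in [set: X]])%E ->
  exists2 c : R, 0 < c & forall x t0, exists2 t, t0 < t & c < Qx P t x (rball rho z e).
Proof.
set I := ereal_inf _ => I0.
have [c c0 cI] : exists2 c : R, 0 < c & (c%:E < I)%E.
  case: I I0 => [r| |//] r0; last by exists 1 => //; rewrite ltry.
  by rewrite lte_fin in r0; exists (r / 2); rewrite ?divr_gt0// lte_fin; lra.
exists c => // x t0; apply: limsup_gt.
by apply: (lt_le_trans cI); apply: ereal_inf_lbound; exists x.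
Qed.

Section contraction.
Variables (z : X) (f : X -> R).
Hypothesis lf : BL f.
Hypothesis cesaro_z : cesaro_ev_continuous P z.
Hypothesis low : forall e : R, 0 < e -> exists2 c : R, 0 < c &
  forall x t0, exists2 t, t0 < t & c < Qx P t x (rball rho z e).

(** [b] bounds the limit superior at all points, but the time from which the bound holds may depend
    on the point. *)
Let asympt_dist (b : R) := 0 <= b /\ forall x (e : R), 0 < e ->
  \forall t \near +oo, `|Qf P t f x - Qf P t f z| <= b + e.

(** The time [s] varies with [x], but [c] depends on [eta] alone and not on [b]; so the gain does
    not degenerate when [b] approaches the best bound. *)
Let contract (eta : R) : 0 < eta -> exists2 c : R, 0 < c < 1 &
  forall b, eta <= b -> asympt_dist b -> asympt_dist (b - c * (b - eta)).
Proof.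
move=> eta0; have cf := Cb_lip lf; have bf := Cb_mfun cf.
have [[M fM] _] := cf.
have [d d0 hd] := cesaro_near cesaro_z lf eta0.
have [c c0 hc] := low d0.
have mB := rball_measurable rhoM z d.
have hP x : exists2 s, 0 <= s & c < fine (P s x (rball rho z d)).
  by have [t t0] := hc x 0; exact: Qx_gt.
have c1 : c < 1.
  have [s _ /lt_le_trans] := hP point; apply.
  rewrite -lee_fin fineK ?fin_num_measure//.
  exact: (probability_le1 (P s point) mB).
exists c; first by rewrite c0.
move=> b eb [b0 hb]; split.
  rewrite subr_ge0 (@le_trans _ _ (1 * (b - eta)))// ?ler_wpM2r ?subr_ge0//; first exact: ltW.
  by rewrite mul1r lerBlDr lerDl ltW.
move=> x e e0; have [s s0 ps] := hP x.
pose g t y := `|Qf P t f y - Qf P t f z|.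
have cg t : Cb (g t) by apply/Cb_norm/CbB => //; [exact: Qf_Cb|exact: Cb_cst].
(* [h] is [eta] on the ball and [b] off it: an asymptotic bound for [g t] at each point. *)
pose h y := b - (b - eta) * \1_(rball rho z d) y.
have bh : bounded_mfun (h : Borel rho -> R).
  apply: bounded_mfunB; first exact: bounded_mfun_cst.
  by apply: bounded_mfunZ; exact: bounded_mfun_indic.
have M0 : 0 <= M by exact: le_trans (fM point).
have g2M t y : g t y <= 2 * M.
  rewrite (le_trans (ler_normB _ _))// mulr_natl mulr2n lerD//.
    exact: (Qf_norm_le PM).
  exact: (Qf_norm_le PM).
have h0 y : 0 <= h y.
  rewrite /h indicE; case: (_ \in _); rewrite ?mulr0 ?subr0// mulr1; lra.
(* Moves the limit superior under the integral: the excess of [g t] over [h] is bounded and tends to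
   0 pointwise, so its integral tends to 0, and the limit superior itself never has to be
   integrated. *)
pose F t y := Num.max (g t y - h y) 0.
have F0 t y : 0 <= F t y by rewrite /F le_max lexx orbT.
have FM t y : `|F t y| <= 2 * M.
  rewrite ger0_norm// /F ge_max mulr_ge0// andbT.
  by rewrite lerBlDr (le_trans (g2M _ _))// lerDl.
have mF t : measurable_fun setT (F t : Borel rho -> R).
  apply: measurable_maxr; last exact: measurable_cst.
  by apply: measurable_funB; [have [] := Cb_mfun (cg t)|exact: bh.1].
have cvF : \int[P s x]_(y in [set: Borel rho]) F t y @[t --> +oo] --> 0.
  rewrite -[X in _ --> X](int_cst (P s x)).
  apply: (@int_cvg_pinfty _ _ _ (P s x) F _ (2 * M)) => // y.
  apply/cvgrPdist_le => e' e'0; have [yB|yB] := pselect (rball rho z d y).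
    have := hd y yB; apply: filterS => t gt.
    rewrite sub0r normrN ger0_norm// /F /h indicE mem_set// mulr1.
    by rewrite ge_max (ltW e'0) andbT subKr lerBlDr (le_trans (ltW gt))// lerDr ltW.
  have := hb y e' e'0; apply: filterS => t gt.
  rewrite sub0r normrN ger0_norm// /F /h indicE memNset// mulr0 subr0.
  by rewrite ge_max (ltW e'0) andbT lerBlDl.
have e20 : 0 < e / 2 by rewrite divr_gt0.
have nF : \forall t \near +oo, \int[P s x]_(y in [set: Borel rho]) F t y <= e / 2.
  move/cvgrPdist_le : cvF => /(_ _ e20); apply: filterS => t.
  by rewrite sub0r normrN; exact: le_trans (ler_norm _).
near=> t.
have t0 : 0 < t by near: t; exact: nbhs_pinfty_gt.
have e1 : `|Qf P t (Pf P s f) x - Qf P t f x| <= e / 2.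
  rewrite (le_trans (Qf_Pf_shift PM x t0 s0 bf fM))//; near: t.
  exact: near_div_le.
have bFt : bounded_mfun (F t : Borel rho -> R) by split => //; exists (2 * M).
have bQ := Cb_mfun (Qf_Cb rhoM PM t cf).
have bg := Cb_mfun (cg t).
have e2 : `|Qf P t (Pf P s f) x - Qf P t f z| <= b - c * (b - eta) + e / 2.
  rewrite -(Pf_Qf rhoM PM u_dense x t0 s0 cf).
  have -> : Pf P s (Qf P t f) x - Qf P t f z =
      \int[P s x]_(y in [set: Borel rho]) (Qf P t f y - Qf P t f z).
    by rewrite (intB _ bQ (bounded_mfun_cst _ _)) int_cst.
  apply: (@le_trans _ _ (\int[P s x]_(y in [set: Borel rho]) g t y)).
    apply: le_normr_Rintegral => //; apply: bounded_mfun_integrable.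
    exact: bounded_mfunB bQ (bounded_mfun_cst _ _).
  apply: (@le_trans _ _ (\int[P s x]_(y in [set: Borel rho]) (h y + F t y))).
    apply: le_int => //; first exact: bounded_mfunD.
    by move=> y; rewrite -lerBlDl /F le_max lexx.
  rewrite intD// lerD//; last by near: t.
  rewrite intB ?int_cst; last 2 first.
  - exact: bounded_mfun_cst.
  - by apply: bounded_mfunZ; exact: bounded_mfun_indic.
  rewrite intZ ?int_indic//; last exact: bounded_mfun_indic.
  by rewrite lerD2l lerN2 mulrC ler_wpM2l ?subr_ge0// ltW.
rewrite -(subrK (Qf P t (Pf P s f) x) (Qf P t f x)) -addrA.
rewrite (le_trans (ler_normD _ _))// distrC.
by rewrite (le_trans (lerD e1 e2))//; lra.
Unshelve. all: by end_near. Qed.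

Lemma Qf_asympt_eq x : Qf P t f x - Qf P t f z @[t --> +oo] --> 0.
Proof.
have cf := Cb_lip lf; have bf := Cb_mfun cf; have [[M fM] _] := cf.
have M0 : 0 <= M by exact: le_trans (fM point).
pose S : set R := asympt_dist.
have S2M : S (2 * M).
  split; first by rewrite mulr_ge0.
  move=> y e e0; near=> t.
  rewrite (le_trans (ler_normB _ _))// mulr_natl mulr2n -addrA lerD//.
    exact: (Qf_norm_le PM).
  by rewrite (@le_trans _ _ M)//; [exact: (Qf_norm_le PM)|rewrite lerDl ltW].
have Slb : has_lbound S by exists 0 => b [].
have Sinf : has_inf S by split => //; exists (2 * M).
have M0' : 0 <= inf S by apply: lb_le_inf => [|b []//]; exists (2 * M).
have infS0 : inf S = 0.
  apply/eqP; move: M0'; rewrite le_eqVlt => /predU1P[<-//|I0].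
  have I20 : 0 < inf S / 2 by rewrite divr_gt0.
  have [c /andP[c0 c1] hc] := contract I20.
  (* With [I = inf S] and [eta = I / 2], some [b < I + c * I / 2] lies in [S]. As [b >= I], its
     image [b - c * (b - I / 2)] is below [I], a contradiction. *)
  have d0 : 0 < c * (inf S / 2) by rewrite mulr_gt0.
  have [b Sb bI] := inf_adherent d0 Sinf.
  have Ib : inf S <= b by apply: ge_inf.
  have Sb' : S (b - c * (b - inf S / 2)).
    by apply: hc => //; rewrite (le_trans _ Ib)//; lra.
  have : inf S <= b - c * (b - inf S / 2) by apply: ge_inf.
  have : c * inf S <= c * b by rewrite ler_pM2l.
  nra.
apply/cvgrPdist_le => e e0; have e20 : 0 < e / 2 by rewrite divr_gt0.
have [b [b0 hb]] := inf_adherent e20 Sinf; rewrite infS0 add0r => be.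
have := hb x _ e20; apply: filterS => t ht.
by rewrite sub0r normrN (le_trans ht)//; lra.
Unshelve. all: by end_near. Qed.

End contraction.

End asymptotic_equality.

(** * Convergence from an invariant measure *)

Section invariant_ergodic.
Context (R : realType) (X : pointedType) (rho : X -> X -> R).
Hypothesis rhoM : is_metric rho.
Variable P : R -> X -> probability (Borel rho) R.
Hypothesis PM : markov_feller_semigroup P.
Variable u : nat -> X.
Hypothesis u_dense : forall x (e : R), 0 < e -> exists n, rho x (u n) < e.
Notation Cb := (bounded_continuous rho).
Notation BL := (bounded_lipschitz rho).
Implicit Types (f : X -> R) (x y z : X) (s t : R) (mu nu : probability (Borel rho) R).

Let Cb_lip f : BL f -> Cb f. Proof. exact: lip_Cb. Qed.

(** A Lindelof argument with the countable family of balls around the dense sequence. The halved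
    radius matches the definition of [charged], so that a non-null ball of the family is directly a
    charged one. *)
Lemma null_cover mu (G : set X) (W : nat -> nat -> Prop) :
  (forall x, G x -> exists n k, W n k /\ rball rho (u n) (k.+1%:R^-1 / 2) x) ->
  (forall n k, W n k -> mu (rball rho (u n) (k.+1%:R^-1 / 2)) = 0%E) ->
  measurable (G : set (Borel rho)) -> mu G = 0%E.
Proof.
move=> GW W0 mG.
pose F (i : nat) : set (Borel rho) :=
  if unpickle i is Some (n, k) then
    (if `[< W n k >] then rball rho (u n) (k.+1%:R^-1 / 2) else set0) else set0.
have F0 i : mu.-negligible (F i).
  rewrite /F; case: unpickle => [[n k]|]; last exact: negligible_set0.
  case: ifPn => [/asboolP Wnk|_]; last exact: negligible_set0.
  by apply/negligibleP; [exact: rball_measurable|exact: W0].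
have GF : G `<=` \bigcup_i F i.
  move=> x /GW[n [k [Wnk xk]]]; exists (pickle (n, k)) => //.
  by rewrite /F pickleK asboolT.
have : mu.-negligible (G : set (Borel rho)).
  by apply: (@negligibleS _ (Borel rho) R mu (\bigcup_i F i)) => //; exact: negligible_bigcup.
by move=> /(@negligibleP _ (Borel rho) R mu _ mG).
Qed.

Lemma support_point mu : exists z, forall e : R, 0 < e -> (0 < mu (rball rho z e))%E.
Proof.
apply: contrapT => /forallNP h.
have {}h x : exists2 e : R, 0 < e & mu (rball rho x e) = 0%E.
  have /existsNP[e /not_implyP[e0 /negP]] := h x.
  by rewrite lt0e measure_ge0 andbT negbK => /eqP; exists e.
have : mu setT = 0%E.
  apply: (@null_cover mu setT
    (fun n k => mu (rball rho (u n) (k.+1%:R^-1 / 2)) = 0%E)) => //.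
  move=> x _; have [e e0 xe] := h x.
  have [k _ /(_ k (leqnn k)) ke] := near_infty_natSinv_lt (PosNum e0).
  have k0 : 0 < k.+1%:R^-1 / 2 :> R by rewrite divr_gt0// invr_gt0.
  have [n xn] := u_dense x k0; exists n, k; split; last by rewrite /rball/= (rhoC rhoM).
  apply/eqP; rewrite eq_le measure_ge0 andbT -xe le_measure ?inE//.
  - exact: rball_measurable.
  - exact: rball_measurable.
  - move=> y; rewrite /rball/= => yn; rewrite (le_lt_trans (rho_triangle rhoM (u n) _ _))//.
    have {}ke : k.+1%:R^-1 < e := ke.
    by apply: (lt_trans _ ke); rewrite [ltRHS]splitr ltrD.
by rewrite probability_setT => /eqP; rewrite onee_eq0.
Qed.

Lemma int_dirac x f : bounded_mfun (f : Borel rho -> R) ->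
  \int[dirac (x : Borel rho)]_y f y = f x.
Proof.
by move=> [mf _]; rewrite /Rintegral integral_dirac ?diracT ?mul1e//; exact/measurable_EFinP.
Qed.

Lemma Qpair_dirac x t f : 0 < t -> Cb f ->
  Qpair P (dirac (x : Borel rho)) t f = Qf P t f x.
Proof.
move=> t0 cf; rewrite (QpairE rhoM PM u_dense _ t0 cf) int_dirac//.
exact: Cb_mfun (Qf_Cb rhoM PM t cf).
Qed.

Lemma invariant_int mu s f : Defs.invariant P mu -> 0 <= s -> bounded_mfun (f : Borel rho -> R) ->
  \int[mu]_(x in [set: Borel rho]) Pf P s f x = \int[mu]_(x in [set: Borel rho]) f x.
Proof.
move=> im s0 bf.
have [A mA|A mA|//|_ ->//] := @int_bind _ _ _ _ _ mu (P s) mu f.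
  by have [h _ _ _ _] := PM; exact: h.
exact/esym/im.
Qed.

Lemma invariant_Qpair mu t f : Defs.invariant P mu -> 0 < t -> Cb f ->
  Qpair P mu t f = \int[mu]_(x in [set: Borel rho]) f x.
Proof.
move=> im t0 cf; rewrite (QpairE_unif rhoM PM u_dense mu t0 cf).
rewrite -[RHS](int_cst (unif t)); apply: eq_Rintegral => s _.
exact: invariant_int (Cb_mfun cf).
Qed.

Lemma QfD t f g x : 0 < t -> Cb f -> Cb g ->
  Qf P t (fun y => f y + g y) x = Qf P t f x + Qf P t g x.
Proof.
move=> t0 cf cg; have bf := Cb_mfun cf; have bg := Cb_mfun cg.
by rewrite !(Qf_Qm PM x t0)//; [exact: intD|exact: bounded_mfunD].
Qed.

Lemma QfZ t c f x : 0 < t -> Cb f -> Qf P t (fun y => c * f y) x = c * Qf P t f x.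
Proof.
move=> t0 cf; have bf := Cb_mfun cf.
by rewrite !(Qf_Qm PM x t0)//; [exact: intZ|exact: bounded_mfunZ].
Qed.

Lemma Qf_cst t c x : 0 < t -> Qf P t (fun=> c) x = c.
Proof.
by move=> t0; rewrite (Qf_Qm PM x t0) ?int_cst//; exact: bounded_mfun_cst.
Qed.

Lemma le_Qf t f g x : 0 < t -> Cb f -> Cb g -> (forall y, f y <= g y) ->
  Qf P t f x <= Qf P t g x.
Proof.
move=> t0 cf cg fg; have bf := Cb_mfun cf; have bg := Cb_mfun cg.
by rewrite !(Qf_Qm PM x t0)//; exact: le_int.
Qed.

(** Lipschitz minorants [g k] increasing to [f] bound the averages of [f] from below by its
    integral, up to [e]. The upper bound is the lower one for [1 - f], and an affine change of scale
    reduces bounded [f] to values in [[0, 1]]. *)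
Lemma portmanteau mu x :
  (forall f, BL f -> Qf P t f x @[t --> +oo] --> \int[mu]_(y in [set: Borel rho]) f y) ->
  forall f, Cb f -> Qf P t f x @[t --> +oo] --> \int[mu]_(y in [set: Borel rho]) f y.
Proof.
move=> h.
have low f (e : R) : Cb f -> (forall y, 0 <= f y <= 1) -> 0 < e ->
    \forall t \near +oo, \int[mu]_(y in [set: Borel rho]) f y - e <= Qf P t f x.
  move=> cf f01 e0; have [//||g [gl g01 _ gf]] := @lip_approx _ _ _ rhoM f.
    move=> y d d0; have [d' d'0 hd'] := cf.2 y d d0; exists d' => // w /hd'.
    by rewrite ltr_norml => /andP[_]; lra.
  have cv : \int[mu]_(y in [set: Borel rho]) g k y @[k --> \oo] -->
      \int[mu]_(y in [set: Borel rho]) f y.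
    apply: (@int_cvg _ _ _ mu _ _ 1) => //.
    - by move=> k; have [] := Cb_mfun (Cb_lip (gl k)).
    - move=> k y; have /andP[g0 gfy] := g01 k y; have /andP[_ fy1] := f01 y.
      by rewrite ger0_norm// (le_trans gfy).
  have e20 : 0 < e / 2 by rewrite divr_gt0.
  have /cvgrPdist_le/(_ _ e20)[k _ /(_ k (leqnn k)) gk] := cv.
  have /cvgrPdist_le/(_ _ e20) := h _ (gl k).
  have T0 : \forall t \near +oo, 0 < t :> R by exact: nbhs_pinfty_gt.
  apply: filterS2 T0 => t t0.
  have : Qf P t (g k) x <= Qf P t f x.
    by apply: (le_Qf x t0 (Cb_lip (gl k)) cf) => y; have /andP[] := g01 k y.
  move: gk => /=; rewrite !ler_norml => /andP[_ +] + /andP[_ +].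
  move: (\int[_]_(_ in _) _) (\int[_]_(_ in _) _) (Qf _ _ _ _) (Qf _ _ _ _) => a b c d.
  lra.
have cvg01 f : Cb f -> (forall y, 0 <= f y <= 1) ->
    Qf P t f x @[t --> +oo] --> \int[mu]_(y in [set: Borel rho]) f y.
  move=> cf f01; apply/cvgrPdist_le => e e0.
  have cf' : Cb (fun y => 1 + -1 * f y) by apply/CbD/CbZ => //; exact: Cb_cst.
  have l1 := low f e cf f01 e0.
  have l2 : \forall t \near +oo,
      \int[mu]_(y in [set: Borel rho]) (1 + -1 * f y) - e <= Qf P t (fun y => 1 + -1 * f y) x.
    apply: low => // y; have /andP[] := f01 y; lra.
  have T0 : \forall t \near +oo, 0 < t :> R by exact: nbhs_pinfty_gt.
  apply: filterS3 T0 l1 l2 => t t0 + +.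
  have bf := Cb_mfun cf.
  rewrite (intD _ (bounded_mfun_cst _ _) (bounded_mfunZ _ bf)) int_cst (intZ _ _ bf).
  rewrite (QfD x t0 (Cb_cst rhoM 1) (CbZ rhoM (-1) cf)) Qf_cst// QfZ//.
  by move=> ? ?; rewrite ler_norml; apply/andP; split; lra.
move=> f cf; have [[M fM] _] := cf.
pose N := M + 1; have N0 : 0 < N by rewrite ltr_wpDl// (le_trans _ (fM point)).
pose g y := (2 * N)^-1 * (N + f y).
have cg : Cb g by apply/CbZ/CbD => //; exact: Cb_cst.
have g01 y : 0 <= g y <= 1.
  have := fM y; rewrite ler_norml => /andP[f1 f2].
  rewrite /g mulr_ge0 ?invr_ge0 ?mulr_ge0 ?(ltW N0)//=; last by rewrite /N; lra.
  by rewrite ler_pdivrMl ?mulr_gt0// mulr1 /N; lra.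
have fE : f = fun y => - N + 2 * N * g y.
  by apply/funext => y; rewrite /g mulVKf ?mulf_neq0 ?gt_eqF// addKr.
have bg := Cb_mfun cg.
have cv : - N + 2 * N * Qf P t g x @[t --> +oo] -->
    - N + 2 * N * \int[mu]_(y in [set: Borel rho]) g y.
  by apply: cvgD; [exact: cvg_cst|apply: cvgM; [exact: cvg_cst|exact: cvg01]].
rewrite [X in _ --> X](_ : _ = - N + (2 * N) * \int[mu]_(y in [set: Borel rho]) g y); last first.
  by rewrite {1}fE (intD _ (bounded_mfun_cst _ _) (bounded_mfunZ _ bg)) int_cst (intZ _ _ bg).
apply: cvg_pinfty_pos_eq cv => t t0.
by rewrite fE (QfD x t0 (Cb_cst rhoM _) (CbZ rhoM _ cg)) Qf_cst// QfZ.
Unshelve. all: by end_near. Qed.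

Lemma ergodic_of_invariant mu z : Defs.invariant P mu ->
  (forall f x, BL f -> Qf P t f x - Qf P t f z @[t --> +oo] --> 0) ->
  weakly_mean_ergodic P.
Proof.
move=> im asy.
have cvz f : BL f -> Qf P t f z @[t --> +oo] --> \int[mu]_(y in [set: Borel rho]) f y.
  move=> lf; have cf := Cb_lip lf; have bf := Cb_mfun cf; have [[M fM] _] := cf.
  have bQ t := Cb_mfun (Qf_Cb rhoM PM t cf).
  have : \int[mu]_(y in [set: Borel rho]) (Qf P t f y - Qf P t f z) @[t --> +oo] --> 0.
    rewrite -[X in _ --> X](int_cst mu).
    apply: (@int_cvg_pinfty _ _ _ mu (fun t y => Qf P t f y - Qf P t f z) _ (M + M)).
    - move=> t; apply: measurable_funB => //; exact: (bQ t).1.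
    - move=> t y; rewrite (le_trans (ler_normB _ _))// lerD//; exact: (Qf_norm_le PM).
    - by move=> y; exact: asy.
  move=> cv0.
  have cv : \int[mu]_(y in [set: Borel rho]) f y -
      \int[mu]_(y in [set: Borel rho]) (Qf P t f y - Qf P t f z) @[t --> +oo] -->
      \int[mu]_(y in [set: Borel rho]) f y.
    by rewrite -[X in _ --> X]subr0; apply: cvgB => //; exact: cvg_cst.
  apply: cvg_pinfty_pos_eq cv => t t0.
  rewrite (intB _ (bQ t) (bounded_mfun_cst _ _)) int_cst.
  by rewrite -(QpairE rhoM PM u_dense mu t0 cf) (invariant_Qpair im t0 cf) subKr.
have cvx x f : Cb f -> Qf P t f x @[t --> +oo] --> \int[mu]_(y in [set: Borel rho]) f y.
  move: f; apply: portmanteau => f lf.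
  have cv : Qf P t f x - Qf P t f z + Qf P t f z @[t --> +oo] -->
      \int[mu]_(y in [set: Borel rho]) f y.
    by rewrite -[X in _ --> X]add0r; apply: cvgD; [exact: asy|exact: cvz].
  by apply: cvg_pinfty_pos_eq cv => t _; rewrite subrK.
have cvnu nu f : Cb f -> Qpair P nu t f @[t --> +oo] --> \int[mu]_(y in [set: Borel rho]) f y.
  move=> cf; have bf := Cb_mfun cf; have [[M fM] _] := cf.
  have bQ t := Cb_mfun (Qf_Cb rhoM PM t cf).
  have cv : \int[nu]_(y in [set: Borel rho]) Qf P t f y @[t --> +oo] -->
      \int[mu]_(y in [set: Borel rho]) f y.
    rewrite -[X in _ --> X](int_cst nu).
    apply: (@int_cvg_pinfty _ _ _ nu (fun t y => Qf P t f y) _ M).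
    - by move=> t; exact: (bQ t).1.
    - by move=> t y; exact: (Qf_norm_le PM).
    - by move=> y; exact: cvx.
  apply: cvg_pinfty_pos_eq cv => t t0.
  by rewrite (QpairE rhoM PM u_dense nu t0 cf).
exists mu; split => // nu inu.
(* Uniqueness: for invariant [nu] the pairing is constant in [t > 0], yet converges to the integral
   against [mu]. *)
apply: probability_lip_unique => // f lf; have cf := Cb_lip lf.
apply: (@cvg_unique _ _ (Qpair P nu t f @[t --> +oo])) => //; last exact: cvnu.
apply: cvg_pinfty_pos_eq (cvg_cst _) => t t0.
by rewrite (invariant_Qpair inu t0 cf).
Unshelve. all: by end_near. Qed.

Lemma ergodic_cesaro : weakly_mean_ergodic P ->
  (forall x, cesaro_ev_continuous P x) /\
  exists z, forall e : R, 0 < e ->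
      (0 < ereal_inf
             [set limf_esup (fun t => (Qx P t x (rball rho z e))%:E) (+oo)%R
             | x in [set: X]])%E.
Proof.
move=> [mu [_ _ h]].
have cvx x f : Cb f -> Qf P t f x @[t --> +oo] --> \int[mu]_(y in [set: Borel rho]) f y.
  move=> cf; apply: cvg_pinfty_pos_eq (h (dirac (x : Borel rho)) f cf) => t t0.
  by rewrite Qpair_dirac.
split.
  move=> x; apply: cesaro_intro => // f y lf.
  rewrite -(subrr (\int[mu]_(y in [set: Borel rho]) f y)).
  by apply: cvgB; apply: cvx; exact: Cb_lip.
have [z hz] := support_point mu; exists z => e e0.
have ct := Cb_lip (tent_bounded_lip rhoM z e0).
have bt := Cb_mfun ct.
(* Weak convergence does not control indicators of balls. The tent lies between those of radii
   [e / 2] and [e], so [a > 0] and eventually the ball has mass at least [a / 2], from any starting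
   point. *)
pose a := \int[mu]_(y in [set: Borel rho]) tent rho z e y.
have e20 : 0 < e / 2 by rewrite divr_gt0.
have a0 : 0 < a.
  apply: (@lt_le_trans _ _ (fine (mu (rball rho z (e / 2))))).
    by rewrite fine_gt0// hz//= (le_lt_trans (probability_le1 mu _)) ?ltry//; exact: rball_measurable.
  rewrite -int_indic; last exact: rball_measurable.
  apply: le_int => //.
    by apply: bounded_mfun_indic; exact: rball_measurable.
  by move=> y; exact: indic_le_tent.
apply: (@lt_le_trans _ _ (a / 2)%:E); first by rewrite lte_fin divr_gt0.
apply: le_ereal_inf_tmp => _ [x _ <-]; apply: limsup_ge.
have a20 : 0 < a / 2 by rewrite divr_gt0.
have /cvgrPdist_le/(_ _ a20) cv := cvx x _ ct.
near=> t.
have t0 : 0 < t by near: t; exact: nbhs_pinfty_gt.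
have mB := rball_measurable rhoM z e.
have : `|a - Qf P t (tent rho z e) x| <= a / 2 by near: t.
rewrite ler_norml => /andP[_ at_].
apply: (@le_trans _ _ (Qf P t (tent rho z e) x)); first lra.
rewrite (Qx_Qm PM x t0 mB) -int_indic// (Qf_Qm PM x t0 bt).
apply: le_int => //; first exact: bounded_mfun_indic.
by move=> y; exact: tent_le_indic.
Unshelve. all: by end_near. Qed.

End invariant_ergodic.

(** * Tightness of the averages *)

Lemma half_le_of_dist (R : realType) (c x y : R) :
  c <= x -> `|x - y| <= c / 2 -> c / 2 <= y.
Proof. by move=> cx; rewrite ler_norml => /andP[_]; lra. Qed.

(** The arithmetic of the gliding hump, [e - e / 2 - e / 8 - e / 8 = e / 4]. Here [a], [b] are
    averages of the whole union at [z], [y], and [c], [d] those of the earlier bumps. *)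
Lemma gap_of_bounds (R : realType) (e a b c d : R) : `|d - c| <= e / 8 ->
  c + e <= a -> b <= d + e / 2 + e / 8 -> e / 4 <= a - b.
Proof. by rewrite ler_norml => /andP[_]; lra. Qed.

Section tightness.
Context (R : realType) (X : pointedType) (rho : X -> X -> R).
Hypothesis rhoM : is_metric rho.
Hypothesis rho_complete : metric_complete rho.
Variable P : R -> X -> probability (Borel rho) R.
Hypothesis PM : markov_feller_semigroup P.
Variable u : nat -> X.
Hypothesis u_dense : forall x (e : R), 0 < e -> exists n, rho x (u n) < e.
Notation Cb := (bounded_continuous rho).
Notation BL := (bounded_lipschitz rho).
Implicit Types (f : X -> R) (x y : X) (s t : R).
Variable z : X.
Hypothesis low : forall e : R, 0 < e -> exists2 c : R, 0 < c &
  forall x t0, exists2 t, t0 < t & c < Qx P t x (rball rho z e).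
Hypothesis asy : forall f x, BL f -> Qf P t f x - Qf P t f z @[t --> +oo] --> 0.

Let Cb_lip f : BL f -> Cb f. Proof. exact: lip_Cb. Qed.

(** Half the radius, because [tent rho x r] equals 1 there and so has positive [P s z]-integral. *)
Definition charged x (r : R) := exists2 s, 0 <= s & (0 < P s z (rball rho x (r / 2)))%E.

Lemma charged_center (e : R) : 0 < e -> charged z e.
Proof.
move=> e0; have e20 : 0 < e / 2 by rewrite divr_gt0.
have [c c0 hc] := low e20; have [t t0 ct] := hc z 0.
have [s s0 ps] := Qx_gt PM t0 (rball_measurable rhoM z (e / 2)) ct.
exists s => //; rewrite -[X in (_ < X)%E]fineK ?fin_num_measure//; last exact: rball_measurable.
by rewrite lte_fin (lt_trans c0).
Qed.

(** Otherwise [G] would be covered by countably many balls that [P s z] does not charge. The closed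
    ball is put inside [G] so that limits of nested centres stay in it. *)
Lemma charged_sub (G : set X) s (d : R) : rho_open rho G -> 0 <= s -> 0 < d ->
  P s z G <> 0%E ->
  exists x r, [/\ 0 < r, r < d, charged x r & forall y, rho x y <= r -> G y].
Proof.
move=> oG s0 d0 PG; apply: contrapT => /forallNP hN; apply: PG.
pose W n k := k.+1%:R^-1 < d /\ forall y, rho (u n) y <= k.+1%:R^-1 -> G y.
have mG : measurable (G : set (Borel rho)) := rho_open_measurable (A := G) oG.
apply: (@null_cover _ _ _ rhoM u (P s z) G W) => //.
- move=> x /oG[b b0 bG].
  have b20 : 0 < b / 2 by rewrite divr_gt0.
  have [k1 _ hk1] := near_infty_natSinv_lt (PosNum b20).
  have [k2 _ hk2] := near_infty_natSinv_lt (PosNum d0).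
  pose k := maxn k1 k2.
  have kb : k.+1%:R^-1 < b / 2 := hk1 k (leq_maxl _ _).
  have kd : k.+1%:R^-1 < d := hk2 k (leq_maxr _ _).
  have k0 : 0 < k.+1%:R^-1 :> R by rewrite invr_gt0.
  have k20 : 0 < k.+1%:R^-1 / 2 :> R by rewrite divr_gt0.
  have [n xn] := u_dense x k20; exists n, k; split; last first.
    by rewrite /rball/= (rhoC rhoM).
  split => // y yn; apply: bG; rewrite /rball/=.
  rewrite (le_lt_trans (rho_triangle rhoM (u n) _ _))//.
  move: kb kd k0 k20 xn yn; move: (k.+1%:R^-1) (rho x (u n)) (rho (u n) y) => K A B; lra.
- move=> n k [kd kG]; apply/eqP; rewrite eq_le measure_ge0 andbT leNgt; apply/negP => h.
  apply: (hN (u n)); exists k.+1%:R^-1; split => //.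
  by exists s.
Qed.

(* Baire's argument, with balls replaced by balls charged by the orbit of [z]. *)
Lemma charged_baire (W : nat -> set X) : (forall k, rho_open rho (W k)) ->
  (forall y, exists k, ~ W k y) ->
  exists k x r, [/\ 0 < r, charged x r &
    forall s, 0 <= s -> P s z (rball rho x r `&` W k) = 0%E].
Proof.
move=> oW Wcap; apply: contrapT => hN.
(* The premises stand under the existential quantifier so that choice yields a function on all
   states. *)
have step (q : nat * (X * R)) : exists p : X * R, 0 < q.2.2 -> charged q.2.1 q.2.2 ->
    [/\ 0 < p.2, p.2 < q.1.+1%:R^-1, charged p.1 p.2 &
      forall y, rho p.1 y <= p.2 -> rball rho q.2.1 q.2.2 y /\ W q.1 y].
  case: q => [k [x r]] /=.
  have [[r0 cx]|nc] := pselect (0 < r /\ charged x r); last first.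
    by exists (x, r) => r0 cx; exfalso; apply: nc.
  have [s [s0 Ps]] : exists s, 0 <= s /\ P s z (rball rho x r `&` W k) <> 0%E.
    apply: contrapT => /forallNP h; apply: hN; exists k, x, r; split => // s s0.
    by apply: contrapT => Ps; apply: (h s).
  have oG : rho_open rho (rball rho x r `&` W k).
    move=> y [yr yW]; have [a a0 ha] := @rball_open _ _ _ rhoM x r y yr.
    have [b b0 hb] := oW k y yW; exists (Num.min a b); first by rewrite lt_min a0.
    by move=> w; rewrite /rball/= lt_min => /andP[/ha ? /hb].
  have k0 : 0 < k.+1%:R^-1 :> R by rewrite invr_gt0.
  have [x' [r' [r'0 r'k cx' h]]] := charged_sub oG s0 k0 Ps.
  by exists (x', r').
have [F hF] := choice step.
pose v := fix v n : X * R := if n is n'.+1 then F (n', v n') else (z, 1).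
have vc n : 0 < (v n).2 /\ charged (v n).1 (v n).2.
  elim: n => [|n [r0 cn]] /=; first by split => //; exact: charged_center.
  by have [] := hF (n, v n) r0 cn.
have vS n y : rho (v n.+1).1 y <= (v n.+1).2 ->
    rball rho (v n).1 (v n).2 y /\ W n y.
  by have [r0 cn] := vc n; have [_ _ _] := hF (n, v n) r0 cn; apply.
have vr n : (v n.+1).2 < n.+1%:R^-1.
  by have [r0 cn] := vc n; have [] := hF (n, v n) r0 cn.
have vball m n : rball rho (v m).1 (v m).2 (v (m + n)%N).1.
  have nest j y : rball rho (v (m + j)%N).1 (v (m + j)%N).2 y ->
      rball rho (v m).1 (v m).2 y.
    elim: j y => [|j IH] y; first by rewrite addn0.
    by rewrite addnS => /ltW/vS[/IH].
  by apply: (nest n); rewrite /rball/= (rho_xx rhoM); have [] := vc (m + n)%N.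
have [|y hy] := rho_complete (u := fun n => (v n).1).
  move=> e e0; have e20 : 0 < e / 2 by rewrite divr_gt0.
  have [N _ hN'] := near_infty_natSinv_lt (PosNum e20).
  have Ne : (v N.+1).2 < e / 2 := lt_trans (vr N) (hN' N (leqnn N)).
  exists N.+1 => m n Nm Nn.
  have := vball N.+1 (m - N.+1)%N; have := vball N.+1 (n - N.+1)%N.
  rewrite !subnKC// /rball/= => h1 h2.
  rewrite (le_lt_trans (rho_triangle rhoM (v N.+1).1 _ _))// (rhoC rhoM (v m).1).
  by rewrite [ltRHS]splitr ltrD// (lt_trans _ Ne).
have [k Wk] := Wcap y; apply: Wk.
(* The limit of the centres is only known to lie in the closed balls, which suffices because [vS] is
   stated for them. *)
suff /vS[] : rho (v k.+1).1 y <= (v k.+1).2 by [].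
apply/ler_addgt0Pr => e e0; have [N hN'] := hy e e0.
have := vball k.+1 N; have := hN' (k.+1 + N)%N (leq_addl _ _).
rewrite /rball/= => h1 h2.
by rewrite (le_trans (rho_triangle rhoM (v (k.+1 + N)%N).1 _ _))// lerD// ltW.
Qed.

(** By the Feller property [P_s] of the tent, equal to [2 * a] at [z], is at least [a] on a ball
    around [z]. That ball keeps mass [c] along arbitrarily large times, so [Q_t P_s] of the tent is
    at least [a * c]; dropping [P_s] costs at most half of it once [t] is large. *)
Lemma charged_recurrent x (r : R) : 0 < r -> charged x r ->
  exists2 b : R, 0 < b & forall t0, exists2 t, t0 < t & b <= Qf P t (tent rho x r) z.
Proof.
move=> r0 [s s0 Ps].
have ct := Cb_lip (tent_bounded_lip rhoM x r0); have bt := Cb_mfun ct.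
have mB := rball_measurable rhoM x (r / 2).
have tent_norm y : `|tent rho x r y| <= 1 by rewrite ger0_norm ?tent_ge0// tent_le1.
pose a := Pf P s (tent rho x r) z / 2.
have a0 : 0 < a.
  rewrite divr_gt0//; apply: (@lt_le_trans _ _ (fine (P s z (rball rho x (r / 2))))).
    by rewrite fine_gt0// Ps/= (le_lt_trans (probability_le1 (P s z) mB)) ?ltry.
  rewrite -int_indic//; apply: le_int => //; first exact: bounded_mfun_indic.
  by move=> y; exact: indic_le_tent.
have cP := Pf_Cb PM s0 ct.
have [d d0 hd] := cP.2 z a a0.
have [c c0 hc] := low d0.
have mBz := rball_measurable rhoM z d.
exists (a * c / 2); first by rewrite divr_gt0// mulr_gt0.
have ac0 : 0 < a * c / 2 by rewrite divr_gt0// mulr_gt0.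
have [t1 [_ ht1]] := near_div_le (2 * 1 * s) ac0.
move=> t0; have [t tm ct'] := hc z (Num.max 0 (Num.max t0 t1)).
move: tm; rewrite !gt_max => /and3P[tp t0t t1t]; exists t => //.
have e1 := le_trans (Qf_Pf_shift PM z tp s0 bt tent_norm) (ht1 t t1t).
have e2 : a * c <= Qf P t (Pf P s (tent rho x r)) z.
  apply: (@le_trans _ _ (a * Qx P t z (rball rho z d))).
    by rewrite ler_pM2l// ltW.
  rewrite (Qx_Qm PM z tp mBz) (Qf_Qm PM z tp (Cb_mfun cP)) -int_indic//.
  rewrite -intZ; last exact: bounded_mfun_indic.
  apply: le_int.
  - by apply: bounded_mfunZ; exact: bounded_mfun_indic.
  - exact: Cb_mfun.
  move=> y; rewrite indicE; case: (boolP (y \in _)) => [|_].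
    rewrite inE => /hd; rewrite ltr_norml mulr1 => /andP[_].
    by rewrite {1}[Pf P s _ z]splitr -/a; lra.
  by rewrite mulr0; apply: Rintegral_ge0 => w _; exact: tent_ge0.
exact: half_le_of_dist e2 e1.
Qed.

(** * Separated bumps of non-vanishing mass at [z] lead to a contradiction *)

Section separated_bumps.
Variables (r eps : R) (F : nat -> set nat) (q : nat -> R).
Hypotheses (r0 : 0 < r) (eps0 : 0 < eps).
Hypothesis F_sep : forall i j, (i < j)%N -> far_apart rho u r (F i) (F j).
Hypothesis q_ge : forall i, i.+1%:R <= q i.
Local Notation T := (tents rho u r).
Hypothesis F_mass : forall i, eps <= Qf P (q i) (T (F i)) z.

Let q0 i : 0 < q i. Proof. exact: lt_le_trans (ltr0Sn _ i) (q_ge i). Qed.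
Let T_lip J : BL (T J). Proof. exact: tents_bounded_lip. Qed.
Let T_Cb J : Cb (T J). Proof. exact: Cb_lip. Qed.
Let T_norm J y : `|T J y| <= 1.
Proof. by rewrite ger0_norm ?tents_ge0// tents_le1. Qed.

Let Funion (J : set nat) := \bigcup_(i in J) F i.

Let union_sep (J K : set nat) : (forall i j, J i -> K j -> (i < j)%N) ->
  far_apart rho u r (Funion J) (Funion K).
Proof.
move=> JK j k [i Ji Fij] [i' Ki' Fi'k].
exact: F_sep (JK _ _ Ji Ki') _ _ Fij Fi'k.
Qed.

Let union1 i : Funion [set i] = F i. Proof. exact: bigcup_set1. Qed.

Let tail (i : nat) := Funion [set j | (i <= j)%N].

(** At each point at most one family [F j] is nonzero, so all sufficiently late tails vanish
    there. *)
Let tail_cvg t y : 0 < t -> Qf P t (T (tail i)) y @[i --> \oo] --> 0.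
Proof.
move=> t0; have -> : (fun i => Qf P t (T (tail i)) y) =
    (fun i => \int[Qm PM t y]_(w in [set: Borel rho]) T (tail i) w).
  by apply/funext => i; exact: (Qf_Qm PM y t0 (Cb_mfun (T_Cb _))).
rewrite -[X in _ --> X](int_cst (Qm PM t y)).
apply: (@int_cvg _ _ _ (Qm PM t y) _ _ 1) => [i|i w|w].
- by have [] := Cb_mfun (T_Cb (tail i)).
- exact: T_norm.
have [i hi] : exists i, T (tail i) w = 0.
  have [[i hi]|/forallNP h] := pselect (exists i, T (tail i.+1) w = 0).
    by exists i.+1.
  exists 0%N; apply/eqP; rewrite eq_le tents_ge0 andbT.
  apply: tents_le => // k [j _ Fjk].
  have sep : far_apart rho u r (F j) (tail j.+1).
    by rewrite -union1; apply: union_sep => a b ->.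
  have [<-|/h//] := tents_far_apart rhoM r0 w sep.
  exact: le_tents.
apply: cvg_near_cst; near=> j.
apply/eqP; rewrite eq_le tents_ge0 andbT -hi.
apply: le_tentsS => k [l /= jl Flk]; exists l => //=; apply: leq_trans jl.
by near: j; exact: nbhs_infty_ge.
Unshelve. all: by end_near. Qed.

(* Schur's gliding hump: otherwise a sparse union of bumps would contradict
   the asymptotic equality of the averages at [y] and at [z]. *)
Lemma bump_lower_bound y :
  exists k, forall i, (k <= i)%N -> eps / 2 <= Qf P (q i) (T (F i)) y.
Proof.
apply: contrapT => /forallNP hN.
have bad k : exists i, (k <= i)%N /\ Qf P (q i) (T (F i)) y < eps / 2.
  apply: contrapT => /forallNP h; apply: (hN k) => i ki; rewrite leNgt.
  by apply/negP => lt; apply: (h i).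
have e80 : 0 < eps / 8 by rewrite divr_gt0.
(* A state holds the indices chosen so far and the last one. The next index is a bad one for [y],
   late enough that the union so far has close averages at [y] and [z], and that everything from it
   on is negligible at the previous time. The initial 0 is only a bound and is not put into the
   set. *)
have step (p : set nat * nat) : exists i, [/\ (p.2 < i)%N,
    Qf P (q i) (T (F i)) y < eps / 2,
    `|Qf P (q i) (T (Funion p.1)) y - Qf P (q i) (T (Funion p.1)) z| <= eps / 8 &
    Qf P (q p.2) (T (tail i)) y <= eps / 8].
  case: p => J i /=.
  have /cvgrPdist_le/(_ _ e80)[N1 [_ hN1]] := asy y (T_lip (Funion J)).
  have /cvgrPdist_le/(_ _ e80)[N2 _ hN2] := tail_cvg y (q0 i).
  have [N3 _ hN3] := nbhs_infty_ger N1.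
  have [i' [ki' bi']] := bad (maxn i.+1 (maxn N2 N3)).
  move: ki'; rewrite !geq_max => /and3P[ii' N2i' N3i']; exists i'; split => //.
    have N1q : N1 < q i'.
      by rewrite (lt_le_trans _ (q_ge i'))// (le_lt_trans (hN3 _ N3i'))// ltr_nat.
    by have := hN1 _ N1q; rewrite sub0r normrN.
  by have := hN2 _ N2i'; rewrite /= sub0r normrN; exact: le_trans (ler_norm _).
have [G hG] := choice step.
pose v := fix v n : set nat * nat := if n is n'.+1 then
  ((v n').1 `|` [set G (v n')], G (v n')) else (set0, 0%N).
have i_lt n : ((v n).2 < (v n.+1).2)%N by have [] := hG (v n).
have i_le m n : ((v m).2 <= (v (m + n)%N).2)%N.
  by elim: n => [|n IH]; rewrite ?addn0// addnS (leq_trans IH)// ltnW.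
have i_ge n : (n <= (v n).2)%N.
  by elim: n => [//|n IH]; exact: leq_ltn_trans IH (i_lt n).
have J_le n i : (v n).1 i -> (i <= (v n).2)%N.
  elim: n i => [//|n IH] i [/IH h|->//].
  by rewrite (leq_trans h)// ltnW.
have J_sub n m i : (v (n + m)%N).1 i -> (v n).1 i \/ ((v n.+1).2 <= i)%N.
  elim: m i => [|m IH] i; first by rewrite addn0; left.
  rewrite addnS => -[/IH//|->]; right.
  by have := i_le n.+1 m; rewrite addSn.
pose J := \bigcup_n (v n).1.
(* At the time of the bump chosen at step [n], the union splits into earlier bumps, this bump and
   later ones. Earlier bumps nearly agree at [y] and [z], later ones are negligible at [y] and only
   help at [z], so this bump creates the gap. *)
have gap n : eps / 4 <= Qf P (q (v n.+1).2) (T (Funion J)) z -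
                      Qf P (q (v n.+1).2) (T (Funion J)) y.
  have [_ h1 h2 _] := hG (v n); have [_ _ _ h3] := hG (v n.+1).
  rewrite -[G (v n)]/((v n.+1).2) in h1 h2.
  set t := q _ in h1 h2 h3 *; have t0 : 0 < t by exact: q0.
  have hz : Qf P t (T (Funion (v n).1)) z + eps <= Qf P t (T (Funion J)) z.
    apply: le_trans (lerD (lexx _) (F_mass (v n.+1).2)) _.
    rewrite -(QfD PM z t0 (T_Cb _) (T_Cb _)).
    apply: (le_Qf PM z t0 (CbD rhoM (T_Cb _) (T_Cb _)) (T_Cb _)) => w.
    rewrite -union1; apply: le_trans (tentsU_far_apart rhoM r0 w _) _.
      by apply: union_sep => a b /J_le la ->; rewrite (leq_ltn_trans la).
    apply: le_tentsS => k [[i vi Fik]|[i /= iE Fik]].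
      by exists i => //; exists n.
    exists i => //; exists n.+1 => //; right; exact: iE.
  have hy : Qf P t (T (Funion J)) y <= Qf P t (T (Funion (v n).1)) y + eps / 2 + eps / 8.
    apply: (@le_trans _ _ (Qf P t (T (Funion (v n).1)) y +
       Qf P t (T (F (v n.+1).2)) y + Qf P t (T (tail (v n.+2).2)) y)); last first.
      by rewrite lerD// lerD2l ltW.
    rewrite -(QfD PM y t0 (T_Cb _) (T_Cb _)).
    rewrite -(QfD PM y t0 (CbD rhoM (T_Cb _) (T_Cb _)) (T_Cb _)).
    apply: (le_Qf PM y t0 (T_Cb _) (CbD rhoM (CbD rhoM (T_Cb _) (T_Cb _)) (T_Cb _))) => w.
    apply: le_trans (lerD (tentsU _ _ _ _ _ _) (lexx _)).
    apply: le_trans (tentsU _ _ _ _ _ _).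
    apply: le_tentsS => k [i [m _ vi] Fik].
    have [vni|ni] : (v n.+1).1 i \/ ((v n.+2).2 <= i)%N.
      have [nm|mn] := leqP n.+1 m.
        by apply: (@J_sub n.+1 (m - n.+1)%N); rewrite subnKC.
      left; rewrite -(subnKC (ltnW mn)); move: (n.+1 - m)%N => l.
      by elim: l => [|l IH]; rewrite ?addn0// addnS; left.
    - case: vni => [vi'|iE]; first by left; left; exists i.
      by left; right; have <- : i = (v n.+1).2 := iE.
    - by right; exists i.
  exact: gap_of_bounds h2 hz hy.
have /cvgrPdist_le/(_ _ e80)[N [_ hN']] := asy y (T_lip (Funion J)).
have [n _ hn] := nbhs_infty_ger N.
have Nq : N < q (v n.+1).2.
  rewrite (lt_le_trans _ (q_ge _))// (le_lt_trans (hn n (leqnn n)))// ltr_nat.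
  by rewrite (leq_ltn_trans (leqnSn n))// ltnS i_ge.
have := hN' _ Nq; rewrite sub0r opprB ler_norml => /andP[_].
by move/(le_trans (gap n)); rewrite ler_pM2l// lef_pV2 ?posrE// ler_nat.
Qed.

Lemma separated_bumps_absurd : False.
Proof.
(* The exceptional sets for the conclusion of [bump_lower_bound], open because [Q_t f] is
   continuous. *)
pose W k := [set y | exists2 i, (k <= i)%N & Qf P (q i) (T (F i)) y < eps / 2].
have oW k : rho_open rho (W k).
  move=> y [i ki yi].
  have [_ cQ] := Qf_Cb rhoM PM (q i) (T_Cb (F i)).
  have [d d0 hd] := cont_open_lt cQ yi.
  by exists d => // w /hd wi; exists i.
have Wcap y : exists k, ~ W k y.
  have [k hk] := bump_lower_bound y; exists k => -[i /hk].
  by rewrite leNgt => /negP.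
have [k [x [r1 [r10 cx null]]]] := charged_baire oW Wcap.
have [b b0 hb] := charged_recurrent r10 cx.
(* Each bump receives [eps / 2 * b] under [Q_t Q_q], half of which is reserved for replacing this by
   [Q_t]. *)
pose a := eps / 2 * b / 2.
have a0 : 0 < a by rewrite !divr_gt0// mulr_gt0// divr_gt0.
(* [N] disjoint bumps of mass [a] would have total mass at least 2, whereas a union of bumps is at
   most 1. *)
have [N _ /(_ N (leqnn N)) hN] := nbhs_infty_ger (2 / a).
have [t0 ht0] : exists t0, forall t, t0 < t -> forall i, (i < N)%N ->
    2 * 1 * q (k + i)%N / t <= a.
  elim: N {hN} => [|n [t0 IH]]; first by exists 0.
  have [t1 [_ ht1]] := near_div_le (2 * 1 * q (k + n)%N) a0.
  exists (Num.max t0 t1) => t; rewrite gt_max => /andP[t0t t1t] i.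
  rewrite ltnS leq_eqVlt => /predU1P[->|]; [exact: ht1|exact: IH].
have [t tm bt] := hb (Num.max 0 t0).
move: tm; rewrite gt_max => /andP[tp t0t].
have mass i : (i < N)%N -> a <= Qf P t (T (F (k + i)%N)) z.
  move=> iN; set j := (k + i)%N.
  have e1 := le_trans (Qf_Qf_shift rhoM PM u_dense z tp (q0 j) (T_Cb (F j)) (T_norm (F j)))
               (ht0 t t0t i iN).
  have cQ := Qf_Cb rhoM PM (q j) (T_Cb (F j)).
  have ctent := Cb_lip (tent_bounded_lip rhoM x r10).
  have mBW : measurable (rball rho x r1 `&` W k : set (Borel rho)).
    by apply: measurableI; [exact: rball_measurable|exact: (@rho_open_measurable _ _ _ _ (oW k))].
  have bI := bounded_mfun_indic R mBW.
  have Q0 : Qf P t (\1_(rball rho x r1 `&` W k)) z = 0.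
    rewrite (QfE PM z tp bI) -[RHS](int_cst (unif t)); apply: eq_Rintegral => s _.
    by rewrite /Pf int_indic// null.
  have e2 : eps / 2 * b <= Qf P t (Qf P (q j) (T (F j))) z.
    apply: (@le_trans _ _ (eps / 2 * (Qf P t (tent rho x r1) z -
        Qf P t (\1_(rball rho x r1 `&` W k)) z))).
      by rewrite Q0 subr0 ler_pM2l ?divr_gt0.
    rewrite (Qf_Qm PM z tp (Cb_mfun ctent)) (Qf_Qm PM z tp bI) (Qf_Qm PM z tp (Cb_mfun cQ)).
    rewrite -(intB _ (Cb_mfun ctent) bI) -(intZ _ _ (bounded_mfunB (Cb_mfun ctent) bI)).
    apply: le_int; [exact: bounded_mfunZ (bounded_mfunB (Cb_mfun ctent) bI)|exact: Cb_mfun|].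
    (* On [W k] the left side is at most 0; off [W k] every bump from index [k] on has average at
       least [eps / 2]. *)
    move=> w; have Q0w : 0 <= Qf P (q j) (T (F j)) w.
      rewrite -(Qf_cst PM 0 w (q0 j)).
      by apply: (le_Qf PM w (q0 j) (Cb_cst rhoM 0) (T_Cb _)) => w'; exact: tents_ge0.
    have [Ww|Ww] := pselect (W k w).
      apply: le_trans Q0w; rewrite pmulr_rle0 ?divr_gt0// subr_le0.
      apply: (le_trans (@tent_le_indic R X rho x r1 w r10)); rewrite !indicE in_setI.
      by rewrite (mem_set Ww) andbT.
    rewrite indicE memNset; last by case.
    rewrite subr0 (@le_trans _ _ (eps / 2 * 1))//.
      by rewrite ler_pM2l ?divr_gt0// tent_le1.
    rewrite mulr1 leNgt; apply/negP => h; apply: Ww; exists j => //; exact: leq_addr.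
  exact: half_le_of_dist e2 e1.
have sum n : (n <= N)%N ->
    n%:R * a <= Qf P t (T (Funion [set j | exists2 i, (i < n)%N & j = (k + i)%N])) z.
  elim: n => [_|n IH nN].
    rewrite mul0r -(Qf_cst PM 0 z tp).
    by apply: (le_Qf PM z tp (Cb_cst rhoM 0) (T_Cb _)) => w; exact: tents_ge0.
  rewrite -natr1 mulrDl mul1r.
  apply: le_trans (lerD (IH (ltnW nN)) (mass n nN)) _.
  rewrite -(QfD PM z tp (T_Cb _) (T_Cb _)).
  apply: (le_Qf PM z tp (CbD rhoM (T_Cb _) (T_Cb _)) (T_Cb _)) => w.
  rewrite -union1; apply: le_trans (tentsU_far_apart rhoM r0 w _) _.
    by apply: union_sep => j j' [i i_n ->] ->; rewrite ltn_add2l.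
  apply: le_tentsS => l [[j [i i_n ->] Fl]|[j -> Fl]].
    by exists (k + i)%N => //; exists i => //; exact: ltnW.
  by exists (k + n)%N => //; exists n.
have := sum N (leqnn N).
have : Qf P t (T (Funion [set j | exists2 i, (i < N)%N & j = (k + i)%N])) z <= 1.
  rewrite -(Qf_cst PM 1 z tp).
  by apply: (le_Qf PM z tp (T_Cb _) (Cb_cst rhoM 1)) => w; exact: tents_le1.
move: hN; rewrite ler_pdivrMr//; lra.
Qed.

End separated_bumps.

Definition net (m : nat) (r : R) : set X := [set x | exists2 j, (j < m)%N & rho (u j) x < r].

Lemma net_open m r : rho_open rho (net m r).
Proof.
move=> x [j jm jx]; have [d d0 hd] := @rball_open _ _ _ rhoM (u j) r x jx.
by exists d => // y /hd jy; exists j.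
Qed.

(** Tightness as total boundedness. If it fails at radius [r], mass outside a finite net persists at
    arbitrarily late times. At each such time finitely many new bumps catch part of it, and
    enlarging the net past them starts the next stage. *)
Lemma tight (eps r : R) : 0 < eps -> 0 < r -> exists m, \forall t \near +oo,
  1 - eps <= Qf P t (\1_(net m r)) z.
Proof.
(* A point outside the net is at least [3 * r'] from the old centres, so a centre within [r' / 2] of
   it is more than [2 * r'] from them, as [far_apart] demands. *)
move=> eps0 r30; pose r' := r / 3; have r0 : 0 < r' by rewrite divr_gt0.
apply: contrapT => /forallNP hN.
have mnet m : measurable (net m r : set (Borel rho)).
  exact: (@rho_open_measurable _ _ _ _ (@net_open m r)).
have nt m (N : R) : exists t, [/\ N <= t, 0 < t & Qf P t (\1_(net m r)) z < 1 - eps].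
  apply: contrapT => /forallNP h; apply: (hN m); exists (Num.max 0 N); split; first exact: num_real.
  move=> t; rewrite gt_max => /andP[t0 Nt]; rewrite leNgt; apply/negP => lt.
  by apply: (h t); split => //; exact: ltW.
pose far m m' := [set k | (k < m')%N /\ forall j, (j < m)%N -> 2 * r' <= rho (u j) (u k)].
have step (p : nat * nat) : exists a : R * nat, [/\ p.2.+1%:R <= a.1, (p.1 <= a.2)%N &
    eps / 2 <= Qf P a.1 (tents rho u r' (far p.1 a.2)) z].
  case: p => m i /=; have [t [it t0 tm]] := nt m i.+1%:R.
  (* The part of the complement of the net that the first new bumps leave uncovered. By density it
     vanishes at each point for large [m'], so at the fixed time [t] it costs at most [eps / 2]. *)
  pose phi m' w := Num.max (1 - \1_(net m r) w - tents rho u r' (far m m') w) 0.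
  have cT m' := Cb_lip (tents_bounded_lip rhoM u r0 (far m m')).
  have b1 : bounded_mfun (fun w : Borel rho => 1 - \1_(net m r) w : R).
    by apply: bounded_mfunB; [exact: bounded_mfun_cst|exact: bounded_mfun_indic].
  have phi01 m' w : 0 <= phi m' w <= 1.
    rewrite /phi le_max lexx orbT ge_max ler01 andbT indicE.
    have := tents_ge0 rho u r' (far m m') w; case: (_ \in _) => /=; lra.
  have mphi m' : measurable_fun setT (phi m' : Borel rho -> R).
    apply: measurable_maxr; last exact: measurable_cst.
    by apply: measurable_funB; [exact: b1.1|have [] := Cb_mfun (cT m')].
  have phi_norm m' w : `|phi m' w| <= 1.
    by have /andP[? ?] := phi01 m' w; rewrite ger0_norm.
  have cv : \int[Qm PM t z]_(w in [set: Borel rho]) phi m' w @[m' --> \oo] --> 0.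
    rewrite -[X in _ --> X](int_cst (Qm PM t z)).
    apply: (@int_cvg _ _ _ (Qm PM t z) phi _ 1) => // w.
    have [wn|wn] := pselect (net m r w).
      apply: cvg_near_cst; apply: nearW => m'; rewrite /phi indicE mem_set//.
      by rewrite subrr sub0r; apply/max_idPr; rewrite oppr_le0 tents_ge0.
    have r20 : 0 < r' / 2 by rewrite divr_gt0.
    have [k wk] := u_dense w r20.
    apply: cvg_near_cst; near=> m'.
    have farm : far m m' k.
      split; first by near: m'; exact: nbhs_infty_gt.
      move=> j jm; have : r <= rho (u j) w.
        by rewrite leNgt; apply/negP => lt; apply: wn; exists j.
      have := rho_triangle rhoM (u k) (u j) w; rewrite (rhoC rhoM (u k)).
      have -> : r = 3 * r' by rewrite /r' mulrCA divff// mulr1.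
      move: wk; lra.
    rewrite /phi indicE memNset// subr0; apply/max_idPr; rewrite subr_le0.
    rewrite -(@tent1 _ _ rho (u k) r' w r0); first exact: le_tents.
    by rewrite (rhoC rhoM) ltW.
  have e20 : 0 < eps / 2 by rewrite divr_gt0.
  have /cvgrPdist_le/(_ _ e20)[M _ hM] := cv.
  pose m' := maxn m M; exists (t, m'); split => //=; first exact: leq_maxl.
  have := hM m' (leq_maxr _ _); rewrite /= sub0r normrN ler_norml => /andP[_ phi2].
  have bphi : bounded_mfun (phi m' : Borel rho -> R) by split => //; exists 1.
  have bT := Cb_mfun (cT m').
  have : \int[Qm PM t z]_(w in [set: Borel rho]) (1 - \1_(net m r) w) <=
      \int[Qm PM t z]_(w in [set: Borel rho]) (tents rho u r' (far m m') w + phi m' w).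
    apply: le_int => //; first exact: bounded_mfunD.
    by move=> w; rewrite -lerBlDl /phi le_max lexx.
  rewrite (intB _ (bounded_mfun_cst _ _) (bounded_mfun_indic R (mnet m))) int_cst.
  rewrite (intD _ bT bphi) -(Qf_Qm PM z t0 bT) -(Qf_Qm PM z t0 (bounded_mfun_indic R (mnet m))).
  move: tm phi2; lra.
have [G hG] := choice step.
pose v := fix v i : nat := if i is i'.+1 then (G (v i', i')).2 else 0%N.
have v_le i j : (v i <= v (i + j)%N)%N.
  elim: j => [|j IH]; first by rewrite addn0.
  by rewrite addnS (leq_trans IH)//; have [] := hG (v (i + j)%N, (i + j)%N).
apply: (@separated_bumps_absurd r' (eps / 2) (fun i => far (v i) (v i.+1))
  (fun i => (G (v i, i)).1)) => //.
- by rewrite divr_gt0.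
- move=> i j ij k k' [ki _] [_ hk']; apply: hk'; rewrite (leq_trans ki)//.
  by have := v_le i.+1 (j - i.+1)%N; rewrite subnKC.
- by move=> i; have [] := hG (v i, i).
- by move=> i; have [] := hG (v i, i).
Unshelve. all: by end_near. Qed.

End tightness.

(** * Representation of smooth positive functionals *)

Section riesz.
Context (R : realType) (X : pointedType) (rho : X -> X -> R).
Hypothesis rhoM : is_metric rho.
Notation Cb := (bounded_continuous rho).
Implicit Types (f g : X -> R) (G U V : set X).
Variable L : (X -> R) -> R.
Hypothesis LD : forall f g, Cb f -> Cb g -> L (fun x => f x + g x) = L f + L g.
Hypothesis LZ : forall c f, Cb f -> L (fun x => c * f x) = c * L f.
Hypothesis L_ge0 : forall f, Cb f -> (forall x, 0 <= f x) -> 0 <= L f.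
Hypothesis L1 : L (fun=> 1) = 1.
Hypothesis L_smooth : forall h : nat -> X -> R, (forall k, Cb (h k)) ->
  (forall k x, 0 <= h k x <= 1) -> (forall k x, h k.+1 x <= h k x) ->
  (forall x, h k x @[k --> \oo] --> 0) -> L (h k) @[k --> \oo] --> 0.

Let Lcst c : L (fun=> c) = c.
Proof.
rewrite (_ : (fun=> c) = fun x : X => c * 1); last by apply/funext => x; rewrite mulr1.
by rewrite (LZ c (Cb_cst rhoM 1)) L1 mulr1.
Qed.

Let L_le f g : Cb f -> Cb g -> (forall x, f x <= g x) -> L f <= L g.
Proof.
move=> cf cg fg; rewrite -subr_ge0 -mulN1r -LZ// -LD//; last exact: CbZ.
by apply: L_ge0 => [|x]; [exact/CbD/CbZ|rewrite mulN1r subr_ge0].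
Qed.

Let below G := [set f | [/\ Cb f, forall x, 0 <= f x & forall x, f x <= \1_G x]].

Let lam G := sup [set L f | f in below G].

Let below0 G : below G (fun=> 0).
Proof. by split => [|//|x]; [exact: Cb_cst|rewrite indicE ler0n]. Qed.

Let below_le1 G f : below G f -> L f <= 1.
Proof.
move=> [cf _ fG]; rewrite -(Lcst 1); apply: L_le => //; first exact: Cb_cst.
by move=> x; rewrite (le_trans (fG x))// indicE lern1 leq_b1.
Qed.

Let le_lam G f : below G f -> L f <= lam G.
Proof.
by move=> bf; apply: ub_le_sup; [exists 1 => _ [g /below_le1 ? <-]|exists f].
Qed.

Let lam_le G b : (forall f, below G f -> L f <= b) -> lam G <= b.
Proof.
move=> h; apply: sup_le_ub; last by move=> _ [f /h ? <-].
by exists (L (fun=> 0)), (fun=> 0).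
Qed.

Let lam_ge0 G : 0 <= lam G.
Proof. by rewrite -(Lcst 0); exact: le_lam. Qed.

Let lam_le1 G : lam G <= 1. Proof. by apply: lam_le => f /below_le1. Qed.

Let le_lamS G U : G `<=` U -> lam G <= lam U.
Proof.
move=> GU; apply: lam_le => f [cf f0 fG]; apply: le_lam; split => // x.
rewrite (le_trans (fG x))// !indicE; case: (boolP (x \in G)) => [/set_mem/GU/mem_set->//|_].
by rewrite ler0n.
Qed.

Let open_approx G : rho_open rho G ->
  exists g : nat -> X -> R, [/\ forall k, below G (g k),
    forall k x, g k x <= g k.+1 x & forall x, g k x @[k --> \oo] --> (\1_G : X -> R) x].
Proof.
move=> oG; have [||g [gl g01 gS gB]] := @lip_approx _ _ _ rhoM (\1_G : X -> R).
- by move=> x; rewrite indicE ler0n lern1 leq_b1.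
- move=> x e e0; rewrite indicE; case: (boolP (x \in G)) => xG; last first.
    by exists 1 => // y _; rewrite sub0r indicE (lt_le_trans (y := 0)) ?oppr_lt0.
  move/set_mem : xG => /oG[d d0 dG]; exists d => // y /dG Gy.
  by rewrite indicE mem_set//= gtrBl.
exists g; split => // k; split; first exact: lip_Cb.
  by move=> x; have /andP[] := g01 k x.
by move=> x; have /andP[] := g01 k x.
Qed.

Let sum_Cb (g : nat -> X -> R) n : (forall k, Cb (g k)) ->
  Cb (fun x => \sum_(i < n) g i x) /\
  L (fun x => \sum_(i < n) g i x) = \sum_(i < n) L (g i).
Proof.
move=> cg; elim: n => [|n [cn IH]].
  rewrite big_ord0 (_ : (fun x => _) = fun=> 0); last by apply/funext => x; rewrite big_ord0.
  by split; [exact: Cb_cst|exact: Lcst].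
rewrite big_ord_recr/= -IH (_ : (fun x => _) = fun x => \sum_(i < n) g i x + g n x).
  by split; [exact: CbD|exact: LD].
by apply/funext => x; rewrite big_ord_recr.
Qed.

(** Where compactness would give a finite subcover, [L_smooth] makes finitely many of the sets
    suffice up to [e]. *)
Let lam_subadditive (G : nat -> set X) f : (forall n, rho_open rho (G n)) ->
  below (\bigcup_n G n) f -> forall e, 0 < e -> exists k, L f <= \sum_(i < k) lam (G i) + e.
Proof.
move=> oG [cf f0 fG] e e0.
have [g hg] := choice (fun n => open_approx (oG n)).
have cg n k : Cb (g n k) by have [/(_ k)[]] := hg n.
have g0 n k x : 0 <= g n k x by have [/(_ k)[_ h _] _ _] := hg n.
have g_le n k x : g n k x <= \1_(G n) x by have [/(_ k)[_ _ h] _ _] := hg n.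
have g_S n k x : g n k x <= g n k.+1 x by have [_ h _] := hg n.
have g_cv n x : g n k x @[k --> \oo] --> (\1_(G n) : X -> R) x by have [_ _ h] := hg n.
(* A diagonal choice: the sums increase with [k], and their limit is at least 1 on the union, so the
   excess [h k] of [f] decreases to 0. *)
pose S k x := \sum_(i < k) g i k x.
have cS k : Cb (S k) by have [] := sum_Cb k (fun i => cg i k).
have LS k : L (S k) = \sum_(i < k) L (g i k) by have [] := sum_Cb k (fun i => cg i k).
have S0 k x : 0 <= S k x by apply: sumr_ge0.
have SS k x : S k x <= S k.+1 x.
  rewrite /S big_ord_recr/= (le_trans (y := \sum_(i < k) g i k.+1 x))//.
    by apply: ler_sum => i _.
  by rewrite lerDl.
pose h k x := Num.max (f x - S k x) 0.
have f1 x : f x <= 1 by rewrite (le_trans (fG x))// indicE lern1 leq_b1.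
have ch k : Cb (h k) by apply: Cb_max => //; [exact: CbB|exact: Cb_cst].
have /cvgrPdist_le/(_ _ e0)[k _ /(_ k (leqnn k)) hk] : L (h k) @[k --> \oo] --> 0.
  apply: L_smooth => //.
  - move=> k x; rewrite /h le_max lexx orbT ge_max ler01 andbT.
    by rewrite lerBlDr (le_trans (f1 x))// lerDl.
  - by move=> k x; rewrite /h ge_max !le_max lexx orbT andbT lerD2l lerN2 SS.
  - move=> x; apply/cvgrPdist_le => d d0.
    have [[n _ Gn]|nG] := pselect ((\bigcup_n G n) x); last first.
      apply: nearW => j; rewrite /h.
      have -> : f x = 0.
        by apply/eqP; rewrite eq_le f0 andbT (le_trans (fG x))// indicE memNset.
      rewrite (max_r (_ : 0 - S j x <= 0)) ?subr0 ?normr0 ?(ltW d0)//.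
      by rewrite sub0r oppr_le0.
    have /cvgrPdist_le/(_ _ d0) := g_cv n x; rewrite indicE mem_set//= => gn.
    near=> j; rewrite sub0r normrN ger0_norm ?le_max ?lexx ?orbT// /h ge_max (ltW d0) andbT.
    have nj : (n < j)%N by near: j; exact: nbhs_infty_gt.
    have : `|1 - g n j x| <= d by near: j.
    rewrite ler_norml => /andP[_]; rewrite lerBlDr => gd.
    rewrite lerBlDr (le_trans (f1 x))// (le_trans gd)// lerD2l.
    rewrite /S (bigD1 (Ordinal nj))//= lerDl; exact: sumr_ge0.
exists k; have Lh : L (h k) <= e.
  by move: hk; rewrite sub0r normrN; exact: le_trans (ler_norm _).
apply: (@le_trans _ _ (L (fun x => S k x + h k x))).
  by apply: L_le => // [|x]; [exact: CbD|rewrite /h -lerBlDl le_max lexx].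
rewrite LD// LS lerD//; apply: ler_sum => i _.
by apply: le_lam; split.
Unshelve. all: by end_near. Qed.

Let mus (A : set X) : R := inf [set lam G | G in [set G | rho_open rho G /\ A `<=` G]].

Let openT : rho_open rho setT. Proof. by move=> x _; exists 1. Qed.

Let mus_le (A : set X) G : rho_open rho G -> A `<=` G -> mus A <= lam G.
Proof.
by move=> oG AG; apply: ge_inf; [exists 0 => _ [V _ <-]; exact: lam_ge0|exists G].
Qed.

Let le_mus (A : set X) b : (forall G, rho_open rho G -> A `<=` G -> b <= lam G) -> b <= mus A.
Proof.
move=> h; apply: lb_le_inf; last by move=> _ [G [oG AG] <-]; exact: h.
by exists (lam setT), setT.
Qed.

Let mus_ge0 A : 0 <= mus A. Proof. by apply: le_mus => G _ _; exact: lam_ge0. Qed.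

Let mus_open G : rho_open rho G -> mus G = lam G.
Proof.
move=> oG; apply/eqP; rewrite eq_le mus_le//=.
by apply: le_mus => V _ ; exact: le_lamS.
Qed.

Definition riesz_outer (A : set X) : \bar R := (mus A)%:E.

Let outer0 : riesz_outer set0 = 0%E.
Proof.
congr EFin; apply/eqP; rewrite eq_le mus_ge0 andbT.
rewrite (le_trans (mus_le (G := set0) _ _))//.
apply: lam_le => f [cf f0 fG]; rewrite -(Lcst 0); apply: L_le => //; first exact: Cb_cst.
by move=> x; rewrite (le_trans (fG x))// indicE in_set0.
Qed.

Let outer_ge0 A : (0 <= riesz_outer A)%E.
Proof. by rewrite lee_fin. Qed.

Let outer_le : {homo riesz_outer : A B / A `<=` B >-> (A <= B)%E}.
Proof.
move=> A B AB; rewrite lee_fin; apply: le_mus => G oG BG; apply: mus_le => //.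
exact: subset_trans BG.
Qed.

Let outer_sigma : sigma_subadditive riesz_outer.
Proof.
move=> F; apply/lee_addgt0Pr => e e0.
have e20 : 0 < e / 2 by rewrite divr_gt0.
have ex n : exists G, [/\ rho_open rho G, F n `<=` G &
    lam G <= mus (F n) + (e / 2) / (2 ^ n.+1)%:R].
  have d0 : 0 < (e / 2) / (2 ^ n.+1)%:R by rewrite divr_gt0// ltr0n expn_gt0.
  have [|_ [G [oG FG] <-] lG] := @inf_adherent _
    [set lam G | G in [set G | rho_open rho G /\ F n `<=` G]] _ d0.
    split; first by exists (lam setT), setT.
    by exists 0 => _ [G _ <-]; exact: lam_ge0.
  by exists G; split => //; exact: ltW.
have [G hG] := choice ex.
have oG n : rho_open rho (G n) by have [] := hG n.
have oU : rho_open rho (\bigcup_n G n).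
  by move=> x [n _ /oG[d d0 dG]]; exists d => // y /dG; exists n.
apply: (@le_trans _ _ (\sum_(i <oo) (lam (G i))%:E + (e / 2)%:E)%E).
  apply: (@le_trans _ _ (lam (\bigcup_n G n))%:E).
    rewrite lee_fin; apply: mus_le => //.
    by move=> x [n _ Fx]; exists n => //; have [_ h _] := hG n; exact: h.
  have s0 : (0 <= \sum_(i <oo) (lam (G i))%:E)%E.
    by apply: nneseries_ge0 => i _ _; rewrite lee_fin.
  have h f : below (\bigcup_n G n) f -> ((L f)%:E <= \sum_(i <oo) (lam (G i))%:E + (e / 2)%:E)%E.
    move=> bf; have [k hk] := lam_subadditive oG bf e20.
    rewrite (@le_trans _ _ (\sum_(i < k) lam (G i) + e / 2)%:E) ?lee_fin//.
    rewrite EFinD leeD2r// -sumEFin.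
    rewrite (nneseries_split 0 k); last by move=> i _; rewrite lee_fin.
    rewrite add0n big_mkord leeDl//.
    by apply: nneseries_ge0 => i _ _; rewrite lee_fin.
  case E : (\sum_(i <oo) (lam (G i))%:E)%E s0 h => [r| |//] _ h; last by rewrite addye// leey.
  by rewrite -EFinD lee_fin; apply: lam_le => f /h; rewrite -EFinD lee_fin.
rewrite [X in (_ <= _ + X%:E)%E](splitr e) EFinD addeA leeD2r//.
apply: le_trans (epsilon_trick xpredT (fun n => outer_ge0 (F n)) (ltW e20)).
apply: lee_nneseries => n _; first by rewrite lee_fin.
by rewrite -EFinD lee_fin; have [] := hG n.
Qed.

HB.instance Definition _ := isOuterMeasure.Build R X riesz_outer
  outer0 outer_ge0 outer_le outer_sigma.

(** Take [f] below [G] and [U], and [g] below [V], the part of [G] where [f < d]. Then [V] contains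
    [E] minus [U], since [f] vanishes off [U]. The positive part of [f - d] vanishes on [V], so
    adding [g] to it stays below [G], which gives additivity up to [d]. *)
Let open_caratheodory U : rho_open rho U -> riesz_outer.-caratheodory U.
Proof.
move=> oU; apply: le_caratheodory_measurable => E; rewrite -EFinD lee_fin.
apply: le_mus => G oG EG.
have oGU : rho_open rho (G `&` U).
  move=> y [yG yU]; have [a a0 ha] := oG y yG; have [b b0 hb] := oU y yU.
  exists (Num.min a b); first by rewrite lt_min a0.
  by move=> w; rewrite /rball/= lt_min => /andP[/ha ? /hb].
apply: (@le_trans _ _ (lam (G `&` U) + mus (E `&` ~` U))).
  by rewrite lerD2r; apply: mus_le => // x [/EG].
rewrite -lerBrDr; apply: lam_le => f [cf f0 fG]; rewrite lerBrDr.
apply/ler_addgt0Pr => d d0.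
pose V := G `&` [set x | f x < d].
have oV : rho_open rho V.
  move=> y [yG yf]; have [a a0 ha] := oG y yG.
  have [b b0 hb] := cont_open_lt cf.2 yf.
  exists (Num.min a b); first by rewrite lt_min a0.
  by move=> w; rewrite /rball/= lt_min => /andP[/ha ? /hb].
have EV : E `&` ~` U `<=` V.
  move=> x [/EG Gx Ux]; split => //=; rewrite (le_lt_trans (fG x))//.
  by rewrite indicE memNset// => -[].
apply: (@le_trans _ _ (L f + lam V)); first by rewrite lerD2l mus_le.
rewrite -lerBrDl; apply: lam_le => g [cg g0 gV]; rewrite lerBrDl.
pose f' x := Num.max (f x - d) 0.
have cf' : Cb f' by have := Cb_max rhoM (CbB rhoM cf (Cb_cst rhoM d)) (Cb_cst rhoM 0).
have : L f <= L f' + d.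
  rewrite -[X in _ + X](Lcst d) -LD//; last exact: Cb_cst.
  apply: L_le => //; first by apply: CbD => //; exact: Cb_cst.
  by move=> x; rewrite -lerBlDr le_max lexx.
have : L f' + L g <= lam G.
  rewrite -LD//; apply: le_lam; split; first exact: CbD.
    by move=> x; rewrite addr_ge0// le_max lexx orbT.
  move=> x; rewrite /f'; have [fd|fd] := ltP (f x) d.
    rewrite max_r ?add0r; last by rewrite subr_le0 ltW.
    rewrite (le_trans (gV x))// !indicE; case: (boolP (x \in V)) => [/set_mem[Gx _]|_].
      by rewrite mem_set.
    by rewrite ler0n.
  have -> : g x = 0.
    apply/eqP; rewrite eq_le g0 andbT (le_trans (gV x))// indicE memNset//.
    by move=> [_ /=]; rewrite ltNge fd.
  rewrite addr0 ge_max; apply/andP; split; last by rewrite indicE ler0n.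
  rewrite lerBlDr (le_trans (fG x))// !indicE in_setI.
  case: (x \in G) => /=; last by rewrite add0r ltW.
  by rewrite (le_trans (y := 1)) ?lern1 ?leq_b1// lerDl ltW.
lra.
Qed.

Let borel_caratheodory (A : set (Borel rho)) : measurable A -> riesz_outer.-caratheodory A.
Proof.
move: A; apply: smallest_sub; last by move=> U; exact: open_caratheodory.
exact: (@sigma_algebra_measurable _ (caratheodory_type riesz_outer)).
Qed.

Definition riesz_measure (A : set (Borel rho)) : \bar R := riesz_outer A.

Let rm0 : riesz_measure set0 = 0%E. Proof. exact: outer0. Qed.
Let rm_ge0 A : (0 <= riesz_measure A)%E. Proof. exact: outer_ge0. Qed.
Let rm_sigma : semi_sigma_additive riesz_measure.
Proof.
move=> F mF tF mUF.
apply: (@caratheodory_measure_sigma_additive R X riesz_outer) => //.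
  by move=> i; exact: borel_caratheodory.
exact: borel_caratheodory.
Qed.

HB.instance Definition _ := isMeasure.Build _ (Borel rho) R riesz_measure
  rm0 rm_ge0 rm_sigma.

Let rmT : riesz_measure setT = 1%E.
Proof.
congr EFin; rewrite mus_open//; apply/eqP; rewrite eq_le lam_le1/= -{1}L1.
apply: le_lam; split; first exact: Cb_cst.
  by move=> _; exact: ler01.
by move=> x; rewrite indicE in_setT.
Qed.

HB.instance Definition _ := Measure_isProbability.Build _ _ _ riesz_measure rmT.

Let mu : probability (Borel rho) R := riesz_measure.

(* Layer by layer: slices of height [d] of [f] are compared with the
   superlevel sets of [f]. *)
Let layer (d : R) j f : 0 < d -> Cb f -> (forall x, 0 <= f x <= j%:R * d) ->
  L f <= \int[mu]_(x in [set: Borel rho]) f x + d * lam [set x | 0 < f x].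
Proof.
move=> d0; elim: j f => [|j IH] f cf fj.
  have f0 x : f x = 0 by have := fj x; rewrite mul0r -eq_le => /eqP.
  rewrite (_ : f = fun=> 0); last exact/funext.
  by rewrite Lcst int_cst add0r mulr_ge0// ltW.
pose f1 x := Num.min (f x) d; pose f2 x := Num.max (f x - d) 0.
have cf1 : Cb f1 by have := Cb_min rhoM cf (Cb_cst rhoM d).
have cf2 : Cb f2 by have := Cb_max rhoM (CbB rhoM cf (Cb_cst rhoM d)) (Cb_cst rhoM 0).
have fE : f = fun x => f1 x + f2 x.
  apply/funext => x; rewrite /f1 /f2; have [fd|fd] := leP (f x) d.
    by rewrite max_r ?addr0// subr_le0.
  by rewrite max_l ?subr_ge0 ?(ltW fd)// addrC subrK.
have op a : rho_open rho [set x | a < f x] by exact: cont_open cf.2.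
have L1' : L f1 <= d * lam [set x | 0 < f x].
  rewrite -ler_pdivrMl// -LZ//; apply: le_lam; split; first exact: CbZ.
    move=> x; rewrite mulr_ge0 ?invr_ge0 ?(ltW d0)// /f1 le_min (ltW d0) andbT.
    by have /andP[] := fj x.
  move=> x; rewrite ler_pdivrMl// indicE; case: (boolP (x \in _)) => [_|].
    by rewrite mulr1 /f1 ge_min lexx orbT.
  by rewrite notin_setE/= => /negP; rewrite -leNgt mulr0 /f1 ge_min => ->.
have L2 : L f2 <= \int[mu]_(x in [set: Borel rho]) f2 x + d * lam [set x | 0 < f2 x].
  apply: IH => // x; rewrite /f2 le_max lexx orbT ge_max mulr_ge0 ?(ltW d0)// andbT.
  by rewrite lerBlDr -[X in _ + X]mul1r -mulrDl natr1; have /andP[] := fj x.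
(* The error of the upper slices is absorbed by the integral of the bottom slice, so errors do not
   add up over the layers. *)
have I1 : d * lam [set x | 0 < f2 x] <= \int[mu]_(x in [set: Borel rho]) f1 x.
  rewrite (_ : [set x | 0 < f2 x] = [set x | d < f x]); last first.
    by apply/seteqP; split => x /=; rewrite /f2 lt_max ltxx orbF subr_gt0.
  have mD : measurable ([set x | d < f x] : set (Borel rho)) by exact: (rho_open_measurable (op d)).
  rewrite -(mus_open (op d)) -[mus _]/(fine (mu [set x | d < f x])).
  rewrite -int_indic// -intZ; last exact: bounded_mfun_indic.
  apply: le_int.
  - by apply: bounded_mfunZ; exact: bounded_mfun_indic.
  - exact: Cb_mfun.
  move=> x; rewrite indicE /f1 le_min; case: (boolP (x \in _)) => [|_].
    by rewrite inE/= mulr1 lexx andbT => /ltW.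
  by rewrite mulr0 (ltW d0) andbT; have /andP[] := fj x.
rewrite {1 2}fE LD// (intD _ (Cb_mfun cf1) (Cb_mfun cf2)); lra.
Qed.

(** [layer] gives only [L f <= \int f]; the converse is this inequality for [1 - f], as both
    functionals send 1 to 1. *)
Lemma riesz : exists mu : probability (Borel rho) R,
  forall f, Cb f -> \int[mu]_(x in [set: Borel rho]) f x = L f.
Proof.
exists mu.
have le01 f : Cb f -> (forall x, 0 <= f x <= 1) ->
    L f <= \int[mu]_(x in [set: Borel rho]) f x.
  move=> cf f01; apply/ler_addgt0Pr => e e0.
  have [n _ /(_ n (leqnn n)) ne] := nbhs_infty_ger e^-1.
  apply: (@le_trans _ _ (\int[mu]_(x in [set: Borel rho]) f x + e * lam [set x | 0 < f x])).
    apply: (@layer e n) => // x; have /andP[-> fx1] := f01 x.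
    by rewrite (le_trans fx1)// -ler_pdivrMr// mul1r.
  by rewrite lerD2l ler_piMr// ltW.
have eq01 f : Cb f -> (forall x, 0 <= f x <= 1) ->
    \int[mu]_(x in [set: Borel rho]) f x = L f.
  move=> cf f01; apply/eqP; rewrite eq_le le01// andbT.
  have bf := Cb_mfun cf.
  have := @le01 (fun x => 1 + -1 * f x) (CbD rhoM (Cb_cst rhoM 1) (CbZ rhoM (-1) cf)) _.
  rewrite (LD (Cb_cst rhoM 1) (CbZ rhoM (-1) cf)) L1 LZ//.
  rewrite (intD _ (bounded_mfun_cst _ _) (bounded_mfunZ _ bf)) int_cst (intZ _ _ bf).
  rewrite lerD2l !mulN1r lerN2; apply => x; have /andP[] := f01 x; lra.
move=> f cf; have [[M fM] _] := cf.
pose N := M + 1; have N0 : 0 < N by rewrite ltr_wpDl// (le_trans _ (fM point)).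
pose g y := (2 * N)^-1 * (N + f y).
have cg : Cb g by apply/CbZ/CbD => //; exact: Cb_cst.
have bg := Cb_mfun cg.
have g01 y : 0 <= g y <= 1.
  have := fM y; rewrite ler_norml => /andP[f1 f2].
  rewrite /g mulr_ge0 ?invr_ge0 ?mulr_ge0 ?(ltW N0)//=; last by rewrite /N; lra.
  by rewrite ler_pdivrMl ?mulr_gt0// mulr1 /N; lra.
have fE : f = fun y => - N + 2 * N * g y.
  by apply/funext => y; rewrite /g mulVKf ?mulf_neq0 ?gt_eqF// addKr.
rewrite fE (intD _ (bounded_mfun_cst _ _) (bounded_mfunZ _ bg)) int_cst (intZ _ _ bg).
by rewrite (LD (Cb_cst rhoM _) (CbZ rhoM _ cg)) Lcst (LZ _ cg) eq01.
Qed.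

End riesz.

(** * Existence of an invariant measure *)

Section ultrafilters.

Lemma ultra_finite_union (T : Type) (U : set_system T) (m : nat) (A : nat -> set T) :
  UltraFilter U -> U [set x | exists2 j, (j < m)%N & A j x] ->
  exists2 j, (j < m)%N & U (A j).
Proof.
move=> UU; elim: m => [|m IH] Um.
  by have [x [j]] := @filter_ex _ U _ _ Um.
have [Am|nAm] := in_ultra_setVsetC (A m) UU; first by exists m.
have [|j jm Aj] := IH; last by exists j => //; exact: ltnW.
apply: filterS (filterI Um nAm) => x [[j jm Aj] nA].
by move: jm; rewrite ltnS leq_eqVlt => /predU1P[jE|jm]; [rewrite jE in Aj|exists j].
Qed.

Lemma ultra_bounded_cvg (R : realType) (T : Type) (U : set_system T) (phi : T -> R) (M : R) :
  UltraFilter U -> (forall t, `|phi t| <= M) -> exists l : R, phi t @[t --> U] --> l.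
Proof.
move=> UU phiM; have cM := @segment_compact R (- M) M.
have FA : (phi @ U) `[- M, M]%classic.
  by apply: (@filterE _ U) => t; rewrite /= in_itv/= -ler_norml.
have [l [_ cl]] := cM (phi @ U) _ FA.
exists l => V nV; have [//|nU] := in_ultra_setVsetC (phi @^-1` V) UU.
have [w [nw Vw]] := cl (~` V) V nU nV.
by case: nw.
Qed.

End ultrafilters.

Section invariant_measure.
Context (R : realType) (X : pointedType) (rho : X -> X -> R).
Hypothesis rhoM : is_metric rho.
Hypothesis rho_complete : metric_complete rho.
Variable P : R -> X -> probability (Borel rho) R.
Hypothesis PM : markov_feller_semigroup P.
Variable u : nat -> X.
Hypothesis u_dense : forall x (e : R), 0 < e -> exists n, rho x (u n) < e.
Notation Cb := (bounded_continuous rho).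
Implicit Types (f : X -> R) (x y : X) (s t : R).
Variable z : X.
Hypothesis tightness : forall eps r : R, 0 < eps -> 0 < r -> exists m, \forall t \near +oo,
  1 - eps <= Qf P t (\1_(net rho u m r)) z.

(* Dini's argument: otherwise the bad points [v N] accumulate, along an
   ultrafilter, at a point where all the [h k] are at least [eta / 2]. *)
Lemma dini_nets (m : nat -> nat) (h : nat -> X -> R) (eta : R) : 0 < eta ->
  (forall k, rho_continuous rho (h k)) -> (forall k x, h k.+1 x <= h k x) ->
  (forall x, h k x @[k --> \oo] --> 0) ->
  exists N, forall x, (forall l, (l <= N)%N -> net rho u (m l) l.+1%:R^-1 x) -> h N x <= eta.
Proof.
move=> eta0 ch hS h0; apply: contrapT => /forallNP hN.
have {}hN N : exists x, (forall l, (l <= N)%N -> net rho u (m l) l.+1%:R^-1 x) /\ eta < h N x.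
  have /existsNP[x /not_implyP[xN /negP]] := hN N.
  by rewrite -ltNge; exists x.
have [v hv] := choice hN.
have h_le k j x : h (k + j)%N x <= h k x.
  by elim: j => [|j IH]; rewrite ?addn0// addnS (le_trans (hS _ _)).
have [V [UV ooV]] := ultraFilterLemma eventually_filter.
(* At each scale the net is finite, so the ultrafilter selects one of its balls; selected balls meet
   pairwise, which makes their centres Cauchy. *)
have ex l : exists2 j, (j < m l)%N & V [set N | rho (u j) (v N) < l.+1%:R^-1].
  apply: (ultra_finite_union (A := fun j => [set N | rho (u j) (v N) < l.+1%:R^-1])) => //.
  by apply: ooV; exists l => // N /= lN; have [+ _] := hv N; apply.
have {ex}/choice[c hc] l : exists j, V [set N | rho (u j) (v N) < l.+1%:R^-1].
  by have [j _ Vj] := ex l; exists j.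
have cc l l' : rho (u (c l)) (u (c l')) < l.+1%:R^-1 + l'.+1%:R^-1.
  have [N [/= h1 h2]] := @filter_ex _ V _ _ (filterI (hc l) (hc l')).
  by rewrite (le_lt_trans (rho_triangle rhoM (v N) _ _))// ltrD// (rhoC rhoM).
have [|x hx] := rho_complete (u := u \o c).
  move=> e e0; have e20 : 0 < e / 2 by rewrite divr_gt0.
  have [N _ hNe] := near_infty_natSinv_lt (PosNum e20).
  exists N => l l' Nl Nl'; rewrite (lt_trans (cc l l'))// [ltRHS]splitr ltrD//.
    exact: hNe.
  exact: hNe.
have cx l : rho (u (c l)) x <= l.+1%:R^-1.
  apply/ler_addgt0Pr => e e0; have e20 : 0 < e / 2 by rewrite divr_gt0.
  have [N1 _ hN1] := near_infty_natSinv_lt (PosNum e20).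
  have [N2 hN2] := hx _ e20; pose l' := maxn N1 N2.
  have k1 : l'.+1%:R^-1 < e / 2 := hN1 l' (leq_maxl _ _).
  have k2 := hN2 l' (leq_maxr _ _).
  rewrite (le_trans (rho_triangle rhoM (u (c l')) _ _))//.
  rewrite [X in _ <= _ + X]splitr addrA lerD//; last exact: ltW.
  by rewrite (le_trans (ltW (cc l l')))// lerD2l ltW.
have hx2 k : eta / 2 <= h k x.
  have eta20 : 0 < eta / 2 by rewrite divr_gt0.
  have [d d0 hd] := ch k x _ eta20.
  have d20 : 0 < d / 2 by rewrite divr_gt0.
  have [l _ /(_ l (leqnn l)) ld] := near_infty_natSinv_lt (PosNum d20).
  have {}ld : l.+1%:R^-1 < d / 2 := ld.
  have kV : V [set N | (k <= N)%N] by apply: ooV; exact: nbhs_infty_ge.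
  have [N [/= h1 kN]] := @filter_ex _ V _ _ (filterI (hc l) kV).
  have xv : rho x (v N) < d.
    rewrite (le_lt_trans (rho_triangle rhoM (u (c l)) _ _))// (rhoC rhoM x) [ltRHS]splitr.
    by rewrite ltrD//; [exact: le_lt_trans ld|exact: lt_trans ld].
  have [_ etaN] := hv N.
  have := h_le k (N - k)%N (v N); rewrite subnKC// => hle.
  have etak := lt_le_trans etaN hle.
  have := hd _ xv; rewrite ltr_norml => /andP[]; lra.
have eta40 : 0 < eta / 4 by rewrite divr_gt0.
have /cvgrPdist_le/(_ _ eta40)[k _ /(_ k (leqnn k))] := h0 x.
rewrite /= sub0r normrN => /(le_trans (ler_norm _))/(le_trans (hx2 k)).
by rewrite ler_pM2l// lef_pV2 ?posrE// ler_nat.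
Qed.

(** Allowing a loss [d / 2 ^ (l + 1)] at radius [1 / (l + 1)], the nets up to [N] intersect in a set
    of mass at least [1 - d], on which [h N <= d] by Dini; off it [h N <= 1], and the sum is
    [2 * d = eta]. As Dini provides a finite [N], only finitely many conditions for large [t] are
    combined. *)
Lemma tight_smooth (h : nat -> X -> R) (eta : R) : 0 < eta -> (forall k, Cb (h k)) ->
  (forall k x, 0 <= h k x <= 1) -> (forall k x, h k.+1 x <= h k x) ->
  (forall x, h k x @[k --> \oo] --> 0) ->
  exists N, \forall t \near +oo, Qf P t (h N) z <= eta.
Proof.
move=> eta0 ch h01 hS h0; pose d := eta / 2.
have d0 : 0 < d by rewrite divr_gt0.
have ex l : exists m, \forall t \near +oo,
    1 - d / (2 ^ l.+1)%:R <= Qf P t (\1_(net rho u m l.+1%:R^-1)) z.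
  by apply: tightness => //; rewrite divr_gt0// ltr0n expn_gt0.
have [m hm] := choice ex.
have [N hN] := dini_nets m d0 (fun k => (ch k).2) hS h0.
pose K := fix K n : set X := if n is n'.+1 then K n' `&` net rho u (m n) n.+1%:R^-1
  else net rho u (m 0%N) 1.
have mnet l : measurable (net rho u (m l) l.+1%:R^-1 : set (Borel rho)).
  exact: (@rho_open_measurable _ _ _ _ (@net_open _ _ _ rhoM u (m l) l.+1%:R^-1)).
have K0 : K 0%N = net rho u (m 0%N) 1%:R^-1 by rewrite /= invr1.
have mK n : measurable (K n : set (Borel rho)).
  by elim: n => [|n IH]; [rewrite K0; exact: (mnet 0%N)|exact: measurableI].
have KP n x : K n x -> forall l, (l <= n)%N -> net rho u (m l) l.+1%:R^-1 x.
  elim: n => [|n IH]; first by rewrite K0 => Kx l; rewrite leqn0 => /eqP ->.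
  by move=> [/IH h1 h2] l; rewrite leq_eqVlt => /predU1P[->//|]; exact: h1.
(* The surplus [d / 2 ^ (n + 1)] is what carries the induction: half of it pays for the next net. *)
have KQ n : \forall t \near +oo, 1 - d + d / (2 ^ n.+1)%:R <= Qf P t (\1_(K n)) z.
  elim: n => [|n IH].
    rewrite K0; apply: filterS (hm 0%N) => t; apply: le_trans.
    by rewrite expn1; lra.
  have T0 : \forall t \near +oo, 0 < t :> R by exact: nbhs_pinfty_gt.
  apply: filterS3 T0 IH (hm n.+1) => t t0 h1 h2.
  have b1 := bounded_mfun_indic R (mK n).
  have b2 := bounded_mfun_indic R (mnet n.+1).
  have b3 := bounded_mfun_indic R (mK n.+1).
  have : Qf P t (\1_(K n)) z + Qf P t (\1_(net rho u (m n.+1) n.+2%:R^-1)) z <=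
         Qf P t (\1_(K n.+1)) z + 1.
    rewrite (Qf_Qm PM z t0 b1) (Qf_Qm PM z t0 b2) (Qf_Qm PM z t0 b3).
    rewrite -(intD _ b1 b2) -[X in _ + X](int_cst (Qm PM t z)).
    rewrite -(intD _ b3 (bounded_mfun_cst _ _)).
    apply: le_int; [exact: bounded_mfunD|exact: bounded_mfunD (bounded_mfun_cst _ _)|].
    move=> x; rewrite !indicE in_setI.
    by case: (_ \in _); case: (_ \in _); rewrite /= ?addr0 ?add0r ?lexx ?ler01 ?lerDl.
  have E : d / (2 ^ n.+1)%:R = d / (2 ^ n.+2)%:R + d / (2 ^ n.+2)%:R.
    by rewrite (expnS 2 n.+1) natrM invfM mulrCA [LHS]splitr mulrC.
  rewrite E in h1; move: h1 h2.
  move: (Qf _ _ _ _) (Qf _ _ _ _) (Qf _ _ _ _) (d / _) => A B C D; lra.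
exists N; have T0 : \forall t \near +oo, 0 < t :> R by exact: nbhs_pinfty_gt.
apply: filterS2 T0 (KQ N) => t t0 hK.
have bh := Cb_mfun (ch N); have bK := bounded_mfun_indic R (mK N).
have b1 := bounded_mfunB (bounded_mfun_cst _ (d + 1)) bK.
have : Qf P t (h N) z <= d + 1 - Qf P t (\1_(K N)) z.
  rewrite (Qf_Qm PM z t0 bh) (Qf_Qm PM z t0 bK).
  rewrite -[X in X - _](int_cst (Qm PM t z)) -(intB _ (bounded_mfun_cst _ _) bK).
  apply: le_int => // x; rewrite indicE; case: (boolP (x \in K N)) => [/set_mem/KP/hN|_].
    by rewrite addrK.
  by rewrite subr0; have /andP[_] := h01 N x; lra.
have : 0 < d / (2 ^ N.+1)%:R by rewrite divr_gt0// ltr0n expn_gt0.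
have -> : eta = d + d by rewrite -splitr.
move: hK; move: (Qf _ _ _ _) (Qf _ _ _ _) (d / _) => A B C; lra.
Qed.

(** One ultrafilter serves all [f] at once, so the limit is linear and positive without extracting
    subsequences; as it refines the neighbourhoods of [+oo], the shift error vanishes and [L] is
    invariant. *)
Lemma exists_invariant : exists mu : probability (Borel rho) R, Defs.invariant P mu.
Proof.
have [U [UU ooU]] := ultraFilterLemma (@proper_pinfty_nbhs R).
have posU : U [set t | 0 < t] by apply: ooU; exact: nbhs_pinfty_gt.
(* The implication lets choice define [L] on all functions; its values off [Cb] are arbitrary. *)
have ex f : exists l : R, Cb f -> Qf P t f z @[t --> U] --> l.
  have [cf|ncf] := pselect (Cb f); last by exists 0.
  have [[M fM] _] := cf.
  have [l hl] := @ultra_bounded_cvg R R U (fun t => Qf P t f z) M UU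
    (fun t => Qf_norm_le PM t z (Cb_mfun cf) fM).
  by exists l.
have [L hL] := choice ex.
have UF : ProperFilter U := ultra_proper.
have Lim f l : Cb f -> Qf P t f z @[t --> U] --> l -> L f = l.
  by move=> cf; apply: cvg_unique => //; exact: hL.
have LimPos f (phi : R -> R) l : Cb f -> (forall t, 0 < t -> phi t = Qf P t f z) ->
    phi t @[t --> U] --> l -> L f = l.
  move=> cf phiE cphi; apply: Lim => //; apply: cvg_trans cphi.
  by apply: near_eq_cvg; apply: filterS posU => t; exact: phiE.
have le_L f (c : R) : Cb f -> U [set t | Qf P t f z <= c] -> L f <= c.
  move=> cf h; rewrite -(cvg_lim _ (hL f cf))//; apply: limr_le => //.
  by apply/cvg_ex; exists (L f); exact: hL.
have LD f g : Cb f -> Cb g -> L (fun x => f x + g x) = L f + L g.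
  move=> cf cg; apply: (@LimPos _ (fun t => Qf P t f z + Qf P t g z)).
  - exact: CbD.
  - by move=> t t0; rewrite (QfD PM z t0 cf cg).
  - by apply: cvgD; exact: hL.
have LZ c f : Cb f -> L (fun x => c * f x) = c * L f.
  move=> cf; apply: (@LimPos _ (fun t => c * Qf P t f z)).
  - exact: CbZ.
  - by move=> t t0; rewrite (QfZ PM c z t0 cf).
  - by apply: cvgM; [exact: cvg_cst|exact: hL].
have Lcst c : L (fun=> c) = c.
  apply: (@LimPos _ (fun=> c)); first exact: Cb_cst.
    by move=> t t0; rewrite (Qf_cst PM c z t0).
  exact: cvg_cst.
have L_le f g : Cb f -> Cb g -> (forall x, f x <= g x) -> L f <= L g.
  move=> cf cg fg; apply: (ler_cvg_to (hL f cf) (hL g cg)).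
  by apply: filterS posU => t t0; exact: (le_Qf PM z t0 cf cg fg).
have Linv s f : 0 <= s -> Cb f -> L (Pf P s f) = L f.
  move=> s0 cf; have [[M fM] _] := cf; have cP := Pf_Cb PM s0 cf.
  apply/eqP; rewrite -subr_eq0 -mulN1r -LZ// -LD//; last exact: CbZ.
  apply/eqP; apply: (@LimPos _ (fun t => Qf P t (Pf P s f) z - Qf P t f z)).
  - by apply: CbD => //; exact: CbZ.
  - by move=> t t0; rewrite (QfD PM z t0 cP (CbZ rhoM (-1) cf)) (QfZ PM (-1) z t0 cf) mulN1r.
  - apply/cvgrPdist_le => e e0; apply: ooU.
    have := near_div_le (2 * M * s) e0.
    have : \forall t \near +oo, 0 < t :> R by exact: nbhs_pinfty_gt.
    apply: filterS2 => t t0; apply: le_trans; rewrite sub0r normrN.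
    exact: (Qf_Pf_shift PM z t0 s0 (Cb_mfun cf) fM).
have [|||mu hmu] := @riesz R X rho rhoM L LD LZ.
- by move=> f cf f0; rewrite -(Lcst 0); apply: L_le => //; exact: Cb_cst.
- exact: Lcst.
- move=> h ch h01 hS h0; apply/cvgrPdist_le => e e0.
  have [N hN] := tight_smooth e0 ch h01 hS h0.
  (* [tight_smooth] controls one index only; monotonicity of [h] and [L] extends the bound to all
     later ones. *)
  have LN : L (h N) <= e by apply: le_L => //; exact: ooU.
  exists N => // k /= Nk.
  have hk x : h k x <= h N x.
    by rewrite -(subnKC Nk); elim: (k - N)%N => [|j IH]; rewrite ?addn0// addnS (le_trans (hS _ _)).
  have Lk0 : 0 <= L (h k).
    rewrite -(Lcst 0); apply: L_le => //; first exact: Cb_cst.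
    by move=> x; have /andP[] := h01 k x.
  by rewrite sub0r normrN ger0_norm// (le_trans _ LN)//; exact: L_le.
exists mu => s A s0 mA.
have mPx (B : set (Borel rho)) : measurable B ->
    measurable_fun setT (fun x : Borel rho => P s x B).
  by have [h _ _ _ _] := PM; exact: h.
rewrite -(bind_probE mu mPx mA).
apply: (@probability_lip_unique _ _ _ rhoM (bind_prob mu mPx) mu) => // f lf.
have cf : Cb f := lip_Cb rhoM lf.
have [B mB|//|_ ->] := @int_bind _ _ _ _ _ mu (P s) (bind_prob mu mPx) f mPx.
- exact: bind_probE.
- exact: Cb_mfun.
by rewrite (hmu _ (Pf_Cb PM s0 cf)) (hmu _ cf) Linv.
Qed.

End invariant_measure.

Theorem theorem3p12 (R : realType) (X : pointedType) (rho : X -> X -> R)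
    (P : R -> X -> probability (Borel rho) R) :
  polish_metric rho ->
  markov_feller_semigroup P ->
  (weakly_mean_ergodic P <->
   ((forall x : X, cesaro_ev_continuous P x) /\
    exists z : X, forall e : R, 0 < e ->
      (0 < ereal_inf
             [set limf_esup (fun t => (Qx P t x (rball rho z e))%:E) (+oo)%R
             | x in [set: X]])%E)).
Proof.
move=> [rhoM rho_complete [u u_dense]] PM; split; first exact: (ergodic_cesaro rhoM PM u_dense).
move=> [cesaro [z hz]].
have low e : 0 < e -> exists2 c : R, 0 < c &
    forall x t0, exists2 t, t0 < t & c < Qx P t x (rball rho z e).
  by move=> /hz; exact: lower_bound.
have asy f x : bounded_lipschitz rho f ->
    Qf P t f x - Qf P t f z @[t --> +oo] --> 0.
  by move=> lf; exact: (Qf_asympt_eq rhoM PM u_dense).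
have [mu imu] := exists_invariant rhoM rho_complete PM
  (tight rhoM rho_complete PM u_dense low asy).
exact: (ergodic_of_invariant rhoM PM u_dense imu asy).
Qed.
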